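(* The Fock space is, up to a positive multiplicative factor, the unique nonzero reproducing kernel Hilbert space of entire functions in which $\partial_z$ is densely defined and the equation $$\partial_z^*=M_z$$ holds on the linear span of the kernel functions (in particular the kernel functions are in the domain of $\partial_z^*$ and of $M_z$). That is: (i) in the Fock space $\partial_z$ is densely defined and the equation holds on the linear span of the kernel functions; and (ii) if $\mathcal H\neq\{0\}$ is a reproducing kernel Hilbert space of entire functions, with reproducing kernel $k(z,\omega)$, in which $\partial_z$ is densely defined and the equation holds on the linear span of the functions $k_\omega=k(\cdot,\omega)$, $\omega\in\mathbb C$, then there is a constant $c>0$ such that $k(z,\omega)=c\,e^{z\overline\omega}$ for all $z,\omega\in\mathbb C$.
   Context: A reproducing kernel Hilbert space on a set $\Omega$ is a Hilbert space $\mathcal H$ of complex-valued functions on $\Omega$ for which there is a function $k:\Omega\times\Omega\to\mathbb C$ such that $k_\omega: z\mapsto k(z,\omega)$ belongs to $\mathcal H$ and $\langle f,k_\omega\rangle=f(\omega)$ for all $f\in\mathcal H$, $\omega\in\Omega$; $k$ is the reproducing kernel and the $k_\omega$ are the kernel functions. Here $\Omega=\mathbb C$. The Fock space consists of the entire functions $f$ with $\frac1\pi\iint_{\mathbb C}|f(z)|^2e^{-|z|^2}dxdy<\infty$ (this quantity being the squared norm); its reproducing kernel is $e^{z\overline\omega}$. On a Hilbert space $\mathcal H$ of analytic functions, $\partial_z f=f'$ and $(M_zf)(z)=zf(z)$ are (possibly unbounded) operators with their maximal domains: $\mathrm{Dom}\,\partial_z=\{f\in\mathcal H: f'\in\mathcal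 H\}$, $\mathrm{Dom}\,M_z=\{f\in\mathcal H: zf\in\mathcal H\}$. $\partial_z^*$ is the Hilbert space adjoint of the densely defined operator $\partial_z$. An operator equality holding on a linear subspace means that the subspace is contained in the domains of both sides and that both sides agree there. *)

(* Defs.v *)
From HB Require Import structures.
From mathcomp Require Import all_boot all_order all_algebra.
From mathcomp Require Import all_classical all_reals all_analysis.
From mathcomp Require Import complex.

Set Implicit Arguments.
Unset Strict Implicit.
Unset Printing Implicit Defensive.

Import Order.TTheory GRing.Theory Num.Theory.
Import numFieldNormedType.Exports.

Local Open Scope classical_set_scope.
Local Open Scope complex_scope.
Local Open Scope ring_scope.

(* R[i] carries its topology and normed-module structure through the alias
   R[i]^o, hence the casts. *)
Definition entire (R : realType) (f : R[i] -> R[i]) : Prop :=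
  forall z : R[i], derivable (f : R[i]^o -> R[i]^o) z 1.

Definition cderiv (R : realType) (f : R[i] -> R[i]) : R[i] -> R[i] :=
  derive1 (f : R[i] -> R[i]^o).

Definition cexp (R : realType) (z : R[i]) : R[i] :=
  (expR (complex.Re z))%:C * (cos (complex.Im z) +i* sin (complex.Im z)).

(* A set of functions on the complex plane with a candidate inner product,
   linear in its first argument; the values of [inner] outside [carrier] are
   irrelevant. *)
Record fspace (R : realType) := FSpace {
  carrier : set (R[i] -> R[i]);
  inner : (R[i] -> R[i]) -> (R[i] -> R[i]) -> R[i] }.

Definition hnorm (R : realType) (H : fspace R) (f : R[i] -> R[i]) : R :=
  Num.sqrt (complex.Re (inner H f f)).

Record is_hilbert (R : realType) (H : fspace R) : Prop := IsHilbert {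
  hilbert_zero : carrier H (fun=> 0);
  hilbert_lin_closed : forall (a : R[i]) (f g : R[i] -> R[i]),
    carrier H f -> carrier H g -> carrier H (fun z => a * f z + g z);
  hilbert_inner_linear : forall (a : R[i]) (f g h : R[i] -> R[i]),
    carrier H f -> carrier H g -> carrier H h ->
    inner H (fun z => a * f z + g z) h = a * inner H f h + inner H g h;
  hilbert_inner_conj : forall f g : R[i] -> R[i],
    carrier H f -> carrier H g -> inner H g f = (inner H f g)^*;
  hilbert_inner_ge0 : forall f : R[i] -> R[i],
    carrier H f -> 0 <= inner H f f;
  hilbert_inner_def : forall f : R[i] -> R[i],
    carrier H f -> inner H f f = 0 -> f = (fun=> 0);
  hilbert_complete : forall u : nat -> R[i] -> R[i],
    (forall n, carrier H (u n)) ->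
    (forall e : R, 0 < e -> exists N : nat, forall m n : nat,
       (N <= m)%N -> (N <= n)%N -> hnorm H (fun z => u m z - u n z) < e) ->
    exists2 f : R[i] -> R[i], carrier H f &
      (fun n => hnorm H (fun z => u n z - f z)) @ \oo --> (0 : R) }.

Definition reproducing_kernel (R : realType) (H : fspace R)
    (k : R[i] -> R[i] -> R[i]) : Prop :=
  forall w : R[i],
    carrier H (k^~ w) /\
    forall f : R[i] -> R[i], carrier H f -> inner H f (k^~ w) = f w.

Definition rkhs (R : realType) (H : fspace R) (k : R[i] -> R[i] -> R[i]) :
  Prop := is_hilbert H /\ reproducing_kernel H k.

Definition nonzero_space (R : realType) (H : fspace R) : Prop :=
  exists f : R[i] -> R[i], carrier H f /\ f <> (fun=> 0).

Definition kernel_span (R : realType) (k : R[i] -> R[i] -> R[i]) :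
    set (R[i] -> R[i]) :=
  [set f | exists (n : nat) (a w : 'I_n -> R[i]),
     f = (fun z => \sum_(j < n) a j * k z (w j))].

(* A possibly unbounded operator; [op_fun] is meaningful on [op_dom] only. *)
Record operator (R : realType) := Operator {
  op_dom : set (R[i] -> R[i]);
  op_fun : (R[i] -> R[i]) -> (R[i] -> R[i]) }.

Definition diff_op (R : realType) (H : fspace R) : operator R :=
  Operator [set f | carrier H f /\ carrier H (cderiv f)] (@cderiv R).

Definition mul_op (R : realType) (H : fspace R) : operator R :=
  Operator [set f | carrier H f /\ carrier H (fun z => z * f z)]
           (fun f z => z * f z).

Definition densely_defined (R : realType) (H : fspace R) (T : operator R) :
    Prop :=
  forall (f : R[i] -> R[i]) (e : R), carrier H f -> 0 < e ->
  exists2 g : R[i] -> R[i], op_dom T g & hnorm H (fun z => f z - g z) < e.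

Definition adjoint_image (R : realType) (H : fspace R) (T : operator R)
    (g : R[i] -> R[i]) : set (R[i] -> R[i]) :=
  [set h | carrier H h /\
     forall f : R[i] -> R[i], op_dom T f ->
       inner H (op_fun T f) g = inner H f h].

(* When T is densely defined, [adjoint_image H T g] has at most one element,
   which is then the value of the adjoint at g. *)
Definition adjoint (R : realType) (H : fspace R) (T : operator R) :
    operator R :=
  Operator [set g | carrier H g /\ adjoint_image H T g !=set0]
           (fun g => xget (fun=> 0) (adjoint_image H T g)).

Definition op_eq_on (R : realType) (A B : operator R)
    (S : set (R[i] -> R[i])) : Prop :=
  [/\ S `<=` op_dom A, S `<=` op_dom B &
      forall f : R[i] -> R[i], S f -> op_fun A f = op_fun B f].

Local Notation area R :=
  (@lebesgue_measure R \x @lebesgue_measure R)%E.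

Definition fock_sqnorm (R : realType) (f : R[i] -> R[i]) : \bar R :=
  ((pi^-1)%:E * \int[area R]_(p in setT)
     (Normc.normc (f (p.1 +i* p.2)) ^+ 2 *
        expR (- (Normc.normc (p.1 +i* p.2) ^+ 2)))%:E)%E.

(* The polarization of [fock_sqnorm]. *)
Definition fock_inner (R : realType) (f g : R[i] -> R[i]) : R[i] :=
  let F (p : R * R) : R[i] := let z := p.1 +i* p.2 in
    f z * (g z)^* * (expR (- (Normc.normc z ^+ 2)))%:C in
  (pi^-1)%:C * (Rintegral (area R) setT (fun p => complex.Re (F p)) +i*
                Rintegral (area R) setT (fun p => complex.Im (F p))).

Definition fock (R : realType) : fspace R :=
  FSpace [set f | entire f /\ (fock_sqnorm f < +oo)%E] (@fock_inner R).

Definition fock_kernel (R : realType) (z w : R[i]) : R[i] := cexp (z * w^*).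

(* Main.v *)
Require Import Defs.
From HB Require Import structures.
From mathcomp Require Import all_boot all_order all_algebra.
From mathcomp Require Import all_classical all_reals all_analysis.
From mathcomp Require Import complex.
From mathcomp Require Import measurable_realfun.
From mathcomp Require Import ring lra.

Set Implicit Arguments.
Unset Strict Implicit.
Unset Printing Implicit Defensive.

Import Order.TTheory GRing.Theory Num.Theory.
Import numFieldNormedType.Exports.

Local Open Scope classical_set_scope.
Local Open Scope complex_scope.
Local Open Scope ring_scope.

(* Uniqueness.  By the uniform boundedness principle the difference quotients
   of the kernel show that f |-> f'(w) is bounded, hence f'(w) = <f, h> for some
   h in H; since the domain of d/dz is dense, the hypothesis on the adjoint
   forces h = z k_w.  Taking f = k_z yields d/dw k(w, z) = conj(z) k(w, z), a
   linear differential equation whose solution is c exp(w conj(z)).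

   Fock space.  Goursat's theorem in logarithmic polar coordinates gives the
   mean value property on circles; averaging over rotations (products of
   three shears, hence area preserving) turns it into the Gaussian mean
   value property, and translating the latter gives the reproducing formula.
   A Cauchy sequence converges pointwise and, by Fatou, in L^2 of the Gaussian
   weight; its limit f satisfies f(w) = <f, k_w>, an expression that can be
   differentiated in w, so f is entire.  The span of the kernel functions is
   dense and lies in the domain of d/dz, and the representer of f |-> f'(w) is
   z k_w. *)

(** * Complex differentiability *)

(** The hypothesis on the adjoint tests f'(w) = <f, z k_w> only for f in the domain of d/dz, and no
    kernel function is known to lie there. This is why f |-> f'(w) has to be bounded on all of H
    before k_z may be inserted. The factor in front of the exponential could still depend on z;
    Hermitian symmetry of k makes it constant, and it is positive because H is not zero.

    Entire means differentiable at every point, without continuity of the derivative, so the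
    integral theorem rests on repeated bisection, and no Taylor expansion of an entire function is
    used.

    A limit of Fock functions is not known to be entire when its norm is first estimated; the
    estimates therefore run in a larger space of square-integrable functions with a semidefinite
    form. Differentiating <f, k_w> in w requires that k_{w+h} - k_w - conj(h) z k_w have norm
    O(|h|^2). Pointwise it is at most a constant times |h|^2 exp(2|z|) |k_w|, and four shifted
    kernels dominate exp(2|z|) |k_w|.

    For the adjoint equation, z k_w belongs to the Fock space because a representer of f |-> f'(w)
    exists in every such space and its values are forced. *)

Section CBasics.
Variable R : realType.
Implicit Types (z w h l : R[i]) (f g : R[i] -> R[i]).

Local Notation nc := Normc.normc.

Lemma nc_ge0 z : 0 <= nc z :> R.
Proof. by case: z => a b; rewrite /= sqrtr_ge0. Qed.

Lemma normr_normc z : `|z| = (nc z)%:C.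
Proof. by case: z. Qed.

Lemma ncE z : nc z ^+ 2 = complex.Re z ^+ 2 + complex.Im z ^+ 2.
Proof. by case: z => a b /=; rewrite sqr_sqrtr // addr_ge0 ?sqr_ge0. Qed.

Lemma nc0 : nc (0 : R[i]) = 0. Proof. exact: Normc.normc0. Qed.
Lemma nc_eq0 z : (nc z == 0) = (z == 0).
Proof. by apply/eqP/eqP => [/Normc.eq0_normc//|->]; rewrite nc0. Qed.
Lemma nc_gt0 z : (0 < nc z) = (z != 0).
Proof. by rewrite lt_def nc_ge0 andbT nc_eq0. Qed.
Lemma ncM z w : nc (z * w) = nc z * nc w. Proof. exact: Normc.normcM. Qed.
Lemma ncD z w : nc (z + w) <= nc z + nc w. Proof. exact: le_normcD. Qed.
Lemma ncN z : nc (- z) = nc z. Proof. exact: normcN. Qed.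
Lemma ncB z w : nc (z - w) = nc (w - z). Proof. by rewrite -ncN opprB. Qed.
Lemma ncJ z : nc (z^*) = nc z.
Proof. by case: z => a b; rewrite /= sqrrN. Qed.
Lemma ncR (r : R) : nc r%:C = `|r|.
Proof. by rewrite /= expr0n addr0 sqrtr_sqr. Qed.
Lemma nc1 : nc (1 : R[i]) = 1. Proof. exact: Normc.normc1. Qed.
Lemma ncV z : nc z^-1 = (nc z)^-1. Proof. exact: Normc.normcV. Qed.

Lemma Re_le_nc z : `|complex.Re z| <= nc z.
Proof.
case: z => a b /=; rewrite -sqrtr_sqr ler_wsqrtr // lerDl sqr_ge0 //.
Qed.
Lemma Im_le_nc z : `|complex.Im z| <= nc z.
Proof.
case: z => a b /=; rewrite -sqrtr_sqr ler_wsqrtr // lerDr sqr_ge0 //.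
Qed.
Lemma nc_le_ReIm z : nc z <= `|complex.Re z| + `|complex.Im z|.
Proof.
rewrite -(ler_pXn2r (n := 2)) ?nnegrE ?nc_ge0 ?addr_ge0 //.
rewrite ncE -(real_normK (num_real (complex.Re z))) -(real_normK (num_real (complex.Im z))).
have := normr_ge0 (complex.Re z); have := normr_ge0 (complex.Im z).
by move: (`|_|) (`|_|) => a b a0 b0; nra.
Qed.

Definition cdiff f z l := forall e : R, 0 < e -> exists2 d : R, 0 < d &
  forall h, nc h < d -> nc (f (z + h) - f z - l * h) <= e * nc h.

Lemma cdiffP f z l :
  cdiff f z l <-> h^-1 *: ((f : R[i]^o -> R[i]^o) (h *: 1 + z) - f z) @[h --> (0 : R[i]^o)^'] --> (l : R[i]^o).
Proof.
split=> [D|/cvgrPdist_le D].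
  apply/cvgrPdist_le => e e0.
  have ee : e = (complex.Re e)%:C by move: e0; rewrite ltcE => /andP[/eqP]; case: e => a b /= ->.
  have re0 : 0 < complex.Re e by move: e0; rewrite ltcE => /andP[].
  have [d d0 Hd] := D _ re0.
  have dC : 0 < d%:C :> R[i] by rewrite ltcR.
  rewrite near_withinE; apply/nbhs_ballP; exists d%:C => //= h hb h0.
  have hd : nc h < d.
    by move: hb; rewrite -ball_normE /= sub0r normrN normr_normc ltcR.
  have := Hd h hd; rewrite normr_normc ee lecR => H.
  have -> : l - h^-1 *: (f (h *: 1 + z) - f z) = - h^-1 * (f (z + h) - f z - l * h).
    rewrite /GRing.scale /= mulr1 [h + z]addrC; field => //.
  by rewrite ncM ncN ncV mulrC ler_pdivrMr ?nc_gt0.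
move=> e e0.
have eC : 0 < e%:C :> R[i] by rewrite ltcR.
have := D _ eC.
rewrite near_withinE => /nbhs_ballP [d /= d0 Hd].
have dd : d = (complex.Re d)%:C by move: d0; rewrite ltcE => /andP[/eqP]; case: (d) => a b /= ->.
have rd0 : 0 < complex.Re d by move: d0; rewrite ltcE => /andP[].
exists (complex.Re d) => // h hd.
have [->|h0] := eqVneq h 0; first by rewrite addr0 mulr0 subrr subr0 nc0 mulr0.
have : `|l - h^-1 *: ((f : R[i]^o -> R[i]^o) (h *: 1 + z) - f z)| <= e%:C.
  apply: Hd => //; rewrite -ball_normE /= sub0r normrN dd normr_normc ltcR //.
rewrite normr_normc lecR.
have -> : l - h^-1 *: (f (h *: 1 + z) - f z) = - h^-1 * (f (z + h) - f z - l * h).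
    rewrite /GRing.scale /= mulr1 [h + z]addrC; field => //.
by rewrite ncM ncN ncV mulrC ler_pdivrMr ?nc_gt0.
Qed.

Lemma derivable_cdiff f z : derivable (f : R[i]^o -> R[i]^o) z 1 -> cdiff f z (cderiv f z).
Proof. move=> D; apply/cdiffP; rewrite /cderiv derive1E. exact: D. Qed.

Lemma cdiff_derivable f z l : cdiff f z l -> derivable (f : R[i]^o -> R[i]^o) z 1.
Proof. by move/cdiffP => H; apply/cvg_ex; exists l. Qed.

Lemma cdiff_unique f z l l' : cdiff f z l -> cdiff f z l' -> l = l'.
Proof.
move=> D D'; apply/eqP; rewrite -subr_eq0 -nc_eq0 eq_le nc_ge0 andbT.
apply/ler_addgt0Pr => e e0; rewrite add0r.
have e2 : 0 < e / 2 by rewrite divr_gt0.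
have [d d0 H] := D _ e2; have [d' d0' H'] := D' _ e2.
pose m := Num.min d d'; have m0 : 0 < m by rewrite lt_min d0.
have m20 : 0 < m / 2 by rewrite divr_gt0.
have mE : nc (m / 2)%:C = m / 2 by rewrite ncR gtr0_norm.
have mm : m / 2 < m by rewrite ltr_pdivrMr // ltr_pMr // ltr1n.
have A := H (m / 2)%:C; have A' := H' (m / 2)%:C.
rewrite mE in A A'.
have {}A := A (lt_le_trans mm _); have {}A' := A' (lt_le_trans mm _).
have := lerD (A _) (A' _); rewrite {1}/m ge_min lexx => /(_ isT).
rewrite /m ge_min lexx orbT -/m => /(_ isT).
rewrite -mulrDl -splitr => B.
have : nc (l - l') * (m / 2) <= e * (m / 2).
  rewrite -{1}mE -ncM; apply: le_trans B.
  rewrite [X in _ <= X + _]ncB; apply: le_trans (ncD _ _).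
  by rewrite le_eqVlt; apply/orP; left; apply/eqP; congr nc; ring.
by rewrite ler_pM2r.
Qed.

Lemma cdiff_cderiv f z l : cdiff f z l -> cderiv f z = l.
Proof.
by move=> H; apply: (cdiff_unique (derivable_cdiff (cdiff_derivable H)) H).
Qed.

Lemma entireP f : entire f <-> forall z, exists l, cdiff f z l.
Proof.
split=> [H z|H z]; first by exists (cderiv f z); apply/derivable_cdiff/H.
by have [l] := H z; apply: cdiff_derivable.
Qed.

End CBasics.

Section CCalc.
Variable R : realType.
Implicit Types (z w h l m : R[i]) (f g : R[i] -> R[i]).
Local Notation nc := Normc.normc.

(** Tolerances are divided by [x + 1] instead of [x] so that a factor that may vanish needs no
    separate case. *)
Lemma mul_div1_le (x e : R) : 0 <= x -> 0 <= e -> x * (e / (x + 1)) <= e.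
Proof.
move=> x0 e0; rewrite mulrA ler_pdivrMr ?ltr_wpDl // mulrC.
by rewrite ler_wpM2l // lerDl.
Qed.

Lemma cdiff_cont f z l : cdiff f z l -> forall e : R, 0 < e -> exists2 d : R, 0 < d &
  forall h, nc h < d -> nc (f (z + h) - f z) < e.
Proof.
move=> D e e0; have [d d0 H] := D 1 ltr01.
have L0 : 0 < nc l + 1 by rewrite ltr_wpDl ?nc_ge0.
exists (Num.min d (e / (nc l + 1))); first by rewrite lt_min d0 divr_gt0.
move=> h; rewrite lt_min ltr_pdivlMr // => /andP[hd he].
apply: le_lt_trans he; rewrite mulrDr mulr1 [leRHS]addrC.
apply: (le_trans (y := nc (f (z + h) - f z - l * h) + nc (l * h))).
  by apply: le_trans (ncD _ _); rewrite subrK.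
by rewrite ncM [nc h * _]mulrC lerD2r; have := H h hd; rewrite mul1r.
Qed.

Lemma cdiff_lin (a : R[i]) f g z l m : cdiff f z l -> cdiff g z m ->
  cdiff (fun z => a * f z + g z) z (a * l + m).
Proof.
move=> Df Dg e e0.
have A0 : 0 < nc a + 1 by rewrite ltr_wpDl ?nc_ge0.
have e1 : 0 < e / 2 / (nc a + 1) by rewrite !divr_gt0.
have e2 : 0 < e / 2 by rewrite divr_gt0.
have [d d0 H] := Df _ e1; have [d' d0' H'] := Dg _ e2.
exists (Num.min d d') => [|h]; first by rewrite lt_min d0.
rewrite lt_min => /andP[/H {}H /H' {}H'].
have -> : a * f (z + h) + g (z + h) - (a * f z + g z) - (a * l + m) * h =
  a * (f (z + h) - f z - l * h) + (g (z + h) - g z - m * h) by ring.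
apply: le_trans (ncD _ _) _; rewrite [e in _ <= e * _]splitr mulrDl lerD // ncM.
apply: le_trans (ler_wpM2l (nc_ge0 _) H) _.
by rewrite mulrA ler_wpM2r ?nc_ge0 // mul_div1_le ?nc_ge0 // ltW.
Qed.

Lemma cdiff_cst a z : cdiff (fun=> a) z 0.
Proof.
by move=> e e0; exists 1 => // h _; rewrite subrr mul0r subr0 nc0 mulr_ge0 ?nc_ge0 ?ltW.
Qed.

Lemma cdiff_id z : cdiff id z 1.
Proof.
move=> e e0; exists 1 => // h _; rewrite mul1r [z + h]addrC addrK subrr nc0.
by rewrite mulr_ge0 ?nc_ge0 ?ltW.
Qed.

Lemma cdiff_affine a b z : cdiff (fun z => a * z + b) z a.
Proof.
by have := cdiff_lin a (@cdiff_id z) (cdiff_cst b z); rewrite addr0 mulr1.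
Qed.

Lemma cdiff_comp f g z l m : cdiff f (g z) l -> cdiff g z m -> cdiff (f \o g) z (l * m).
Proof.
move=> Df Dg e e0.
have L0 : 0 < nc l + 1 by rewrite ltr_wpDl ?nc_ge0.
have M0 : 0 < nc m + 1 by rewrite ltr_wpDl ?nc_ge0.
(* The bound 1 yields |k| <= (|m| + 1)|h| for the increment k of [g]; the other bound makes l (k - m
   h) small. *)
have e1 : 0 < Num.min 1 (e / 2 / (nc l + 1)) by rewrite lt_min ltr01 !divr_gt0.
have e2 : 0 < e / 2 / (nc m + 1) by rewrite !divr_gt0.
have [d1 d10 H1] := Dg _ e1; have [d2 d20 H2] := Df _ e2.
have [d3 d30 H3] := cdiff_cont Dg d20.
exists (Num.min d1 d3) => [|h]; first by rewrite lt_min d10.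
rewrite lt_min => /andP[/H1 {}H1 /H3 /H2].
set k := g (z + h) - g z in H1 *.
rewrite [g z + k]addrC subrK => {}H2 /=.
have H1a : nc (k - m * h) <= 1 * nc h.
  by apply: le_trans H1 _; rewrite ler_wpM2r ?nc_ge0 // ge_min lexx.
have {}H1 : nc (k - m * h) <= e / 2 / (nc l + 1) * nc h.
  by apply: le_trans H1 _; rewrite ler_wpM2r ?nc_ge0 // ge_min lexx orbT.
have kb : nc k <= (nc m + 1) * nc h.
  rewrite -(subrK (m * h) k); apply: le_trans (ncD _ _) _.
  by rewrite ncM mulrDl addrC lerD2l.
have -> : f (g (z + h)) - f (g z) - l * m * h =
   (f (g (z + h)) - f (g z) - l * k) + l * (k - m * h) by ring.
apply: le_trans (ncD _ _) _; rewrite [e in _ <= e * _]splitr mulrDl lerD //.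
  apply: le_trans H2 _; apply: le_trans (ler_wpM2l (ltW e2) kb) _.
  by rewrite mulrA divfK // gt_eqF.
rewrite ncM; apply: le_trans (ler_wpM2l (nc_ge0 _) H1) _.
by rewrite mulrA ler_wpM2r ?nc_ge0 // mul_div1_le ?nc_ge0 // ltW // divr_gt0.
Qed.

Lemma cdiff_mul f g z l m : cdiff f z l -> cdiff g z m ->
  cdiff (fun z => f z * g z) z (l * g z + f z * m).
Proof.
move=> Df Dg e e0.
(* [K] adds up the coefficients of the three error terms below; the 1 is there because |g(z + h)| <=
   |g z| + 1 for small h. *)
pose K := nc (g z) + 1 + nc l + nc (f z).
have K0 : 0 < K by rewrite /K -addrA ltr_wpDr ?addr_ge0 ?nc_ge0 // ltr_wpDl ?nc_ge0.
have eK : 0 < e / K by rewrite divr_gt0.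
have e1 : 0 < Num.min 1 (e / K) by rewrite lt_min ltr01.
have [d1 d10 H1] := Df _ eK; have [d2 d20 H2] := Dg _ eK.
have [d3 d30 H3] := cdiff_cont Dg e1.
exists (Num.min d1 (Num.min d2 d3)) => [|h]; first by rewrite !lt_min d10 d20.
rewrite !lt_min => /and3P[/H1 {}H1 /H2 {}H2 /H3]; rewrite lt_min => /andP[/ltW H4 /ltW {}H3].
have -> : f (z + h) * g (z + h) - f z * g z - (l * g z + f z * m) * h =
   (f (z + h) - f z - l * h) * g (z + h) + l * h * (g (z + h) - g z)
   + f z * (g (z + h) - g z - m * h) by ring.
have Hg : nc (g (z + h)) <= nc (g z) + 1.
  by rewrite -(subrK (g z) (g (z + h))) addrC; apply: le_trans (ncD _ _) _; rewrite lerD2l.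
have -> : e * nc h = e / K * nc h * (nc (g z) + 1) + nc l * nc h * (e / K) + nc (f z) * (e / K * nc h).
  by rewrite /K; field; apply: lt0r_neq0; exact: K0.
apply: le_trans (ncD _ _) _; apply: lerD; last by rewrite ncM ler_wpM2l ?nc_ge0.
apply: le_trans (ncD _ _) _; apply: lerD.
  by rewrite ncM ler_pM ?nc_ge0.
by rewrite !ncM ler_wpM2l // mulr_ge0 ?nc_ge0.
Qed.

(** On the segment from 0 to z the real and the imaginary part of [f] are functions of one real
    variable with zero derivative; [p] stands for either part. *)
Lemma cderiv0_cst f : (forall z, cdiff f z 0) -> forall z, f z = f 0.
Proof.
move=> D z.
have P (p : R[i] -> R) : (forall a b, p (a - b) = p a - p b) -> (forall a, `|p a| <= nc a) ->
   p (f z) = p (f 0).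
  move=> pB ple.
  pose r (t : R) := p (f (t%:C * z)).
  have dr (t : R) : is_derive t (1 : R) r 0.
    have cv : h^-1 *: (r (h *: 1 + t) - r t) @[h --> (0 : R)^'] --> (0 : R).
      apply/cvgrPdist_le => e e0.
      have Z0 : 0 < nc z + 1 by rewrite ltr_wpDl ?nc_ge0.
      have eZ : 0 < e / (nc z + 1) by rewrite divr_gt0.
      have [d d0 H] := D (t%:C * z) _ eZ.
      near=> h.
      have h0 : h != 0 by near: h; exact: nbhs_dnbhs_neq.
      have hd : `|h| < d / (nc z + 1) by near: h; apply: dnbhs0_lt; rewrite divr_gt0.
      have nch : nc (h%:C * z) = `|h| * nc z by rewrite ncM ncR.
      have := H (h%:C * z); rewrite nch => {}H.
      rewrite sub0r normrN normrM normfV.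
      have h1 : 0 < `|h| by rewrite normr_gt0.
      rewrite mulrC ler_pdivrMr // /r -pB; apply: le_trans (ple _) _.
      have -> : (h *: 1 + t)%:C * z = t%:C * z + h%:C * z.
        by rewrite -mulrDl -rmorphD /= [h *: 1]mulr1 addrC.
      move: H; rewrite mul0r subr0 => H; apply: le_trans (H _) _.
        move: hd; rewrite ltr_pdivlMr // mulrDr mulr1 => hd.
        by apply: le_lt_trans hd; rewrite lerDl.
      by rewrite mulrCA [leRHS]mulrC ler_wpM2l // mulrC mul_div1_le ?nc_ge0 // ltW.
    apply: DeriveDef; first by apply/cvg_ex; exists 0.
    exact: cvg_lim cv.
  have := is_derive_0_is_cst 1 0 dr; by rewrite /r mul1r mul0r.
have ple1 (a : R[i]) : `|complex.Re a| <= nc a by apply: Re_le_nc.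
have ple2 (a : R[i]) : `|complex.Im a| <= nc a by apply: Im_le_nc.
apply/eqP; rewrite eq_complex P ?P //; last 2 first.
- by case=> ? ? [].
- by case=> ? ? [].
by rewrite !eqxx.
Unshelve. all: by end_near. Qed.

End CCalc.

(** * The complex exponential *)

Section CExp.
Variable R : realType.
Implicit Types (z w h l m : R[i]) (f g : R[i] -> R[i]).
Local Notation nc := Normc.normc.
Local Notation cexp := (@cexp R).

Lemma cexpD z w : cexp (z + w) = cexp z * cexp w.
Proof.
case: z w => a b [c d]; rewrite /Defs.cexp /= expRD cosD sinD; simpc.
by congr Complex; ring.
Qed.

Lemma cexp0 : cexp 0 = 1.
Proof. by rewrite /Defs.cexp /= expR0 cos0 sin0; simpc. Qed.

Lemma nc_cexp z : nc (cexp z) = expR (complex.Re z).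
Proof.
rewrite /Defs.cexp ncM ncR ger0_norm ?expR_ge0 // /= cos2Dsin2 sqrtr1 mulr1 //.
Qed.

Lemma cexpJ z : (cexp z)^* = cexp z^*.
Proof.
case: z => a b; rewrite /Defs.cexp /= cosN sinN; simpc; congr Complex; ring.
Qed.

Lemma cexp_neq0 z : cexp z != 0.
Proof. by rewrite -nc_eq0 nc_cexp gt_eqF ?expR_gt0. Qed.

(** [M] may depend on [b]: a first-order bound for the derivative then gives a second-order bound
    for the function, which is how the estimates below build on each other. *)
Lemma lipschitz0 (f df : R -> R) (M b : R) : (forall x : R, is_derive x (1 : R) f (df x)) ->
  (forall x, `|x| <= `|b| -> `|df x| <= M) -> `|f b - f 0| <= M * `|b|.
Proof.
move=> D B.
have cf : continuous f.
  move=> x; have Dx := D x.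
  by apply/differentiable_continuous/derivable1_diffP; exact: ex_derive.
have M0 : 0 <= M by apply: le_trans (B 0 _); rewrite ?normr0.
have [b0|b0] := leP 0 b.
  have [|c] := @MVT_segment R f df 0 b b0 (fun x _ => D x); first exact: continuous_subspaceT.
  rewrite in_itv /= => /andP[c0 cb] ->; rewrite subr0 normrM ler_wpM2r //.
  by apply: B; rewrite !ger0_norm.
have [|c] := @MVT_segment R f df b 0 (ltW b0) (fun x _ => D x); first exact: continuous_subspaceT.
rewrite in_itv /= distrC => /andP[c0 cb] ->; rewrite sub0r normrM normrN ler_wpM2r //.
by apply: B; rewrite !ler0_norm ?lerN2 // ltW.
Qed.


Lemma abs_sin_le (b : R) : `|sin b| <= `|b|.
Proof.
have := @lipschitz0 sin cos 1 b _ _; rewrite sin0 subr0 mul1r; apply.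
by move=> x _; exact: cos_max.
Qed.

Lemma abs_cosB1_le (b : R) : `|cos b - 1| <= `|b| * `|b|.
Proof.
have := @lipschitz0 cos (fun x => - sin x) `|b| b _ _; rewrite cos0; apply.
by move=> x xb; rewrite normrN; apply: le_trans (abs_sin_le _) xb.
Qed.

Lemma abs_sinB_le (b : R) : `|sin b - b| <= 2 * (`|b| * `|b|).
Proof.
have [b1|b1] := leP `|b| 1.
  have D (x : R) : is_derive x (1 : R) (fun x => sin x - x) (cos x - 1) by exact: is_deriveB.
  have := @lipschitz0 _ _ `|b| b D.
  rewrite sin0 !subr0 => H; apply: le_trans (H _) _.
    move=> x xb; apply: le_trans (abs_cosB1_le _) _.
    by apply: (@le_trans _ _ (`|b| * `|b|)); rewrite ?ler_pM ?ler_piMl.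
  by rewrite ler_peMl ?mulr_ge0 // ler1n.
apply: le_trans (ler_normB _ _) _; rewrite mulrDl mul1r.
apply: lerD; first apply: le_trans (abs_sin_le _) _.
  by rewrite ler_peMl // ltW.
by rewrite ler_peMl // ltW.
Qed.

Lemma abs_expRB1_le (a : R) : `|expR a - 1| <= expR `|a| * `|a|.
Proof.
have := @lipschitz0 expR expR (expR `|a|) a _ _; rewrite expR0; apply.
move=> x xa; rewrite ger0_norm ?expR_ge0 // ler_expR.
exact: le_trans (ler_norm _) xa.
Qed.

Lemma abs_expRB1x_le (a : R) : `|expR a - 1 - a| <= expR `|a| * (`|a| * `|a|).
Proof.
have D (x : R) : is_derive x (1 : R) (fun x => expR x - x) (expR x - 1) by exact: is_deriveB.
have := @lipschitz0 _ _ (expR `|a| * `|a|) a D.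
rewrite expR0 subr0 mulrA [_ - 1 - a]addrAC; apply.
move=> x xa; apply: le_trans (abs_expRB1_le _) _.
by apply: ler_pM; rewrite ?expR_ge0 ?ler_expR.
Qed.

(** Splitting products into telescoping differences, the real part contributes 2 and the imaginary
    part 3 multiples of |h|^2 exp(|h|). The factor exp(|h|) makes the bound global: it is needed
    later with h replaced by z conj(h) and z unbounded, as well as for the derivative of [cexp]. *)
Lemma cexp_bound h : nc (cexp h - 1 - h) <= 6 * nc h ^+ 2 * expR (nc h).
Proof.
have Eh (x : R) : `|x| <= nc h -> expR `|x| <= expR (nc h) by rewrite ler_expR.
have E1 : 1 <= expR (nc h) by rewrite -expR0 ler_expR nc_ge0.
set E := expR (nc h) in Eh E1 *.
have Ra := Re_le_nc h; have Rb := Im_le_nc h; set n := nc h in Ra Rb Eh *.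
have n0 : 0 <= n := nc_ge0 h.
apply: le_trans (nc_le_ReIm _) _.
have -> : complex.Re (cexp h - 1 - h) = expR (complex.Re h) * cos (complex.Im h) - 1 - complex.Re h.
  by case: (h) => a b; rewrite /Defs.cexp /=; ring.
have -> : complex.Im (cexp h - 1 - h) = expR (complex.Re h) * sin (complex.Im h) - complex.Im h.
  by case: (h) => a b; rewrite /Defs.cexp /=; ring.
move: (complex.Re h) (complex.Im h) Ra Rb => a b Ra Rb.
have sq (x y : R) : `|x| <= n -> `|y| <= n -> `|x| * `|y| <= n ^+ 2.
  by move=> ? ?; rewrite expr2 ler_pM.
have Ea := Eh _ Ra.
have n20 : 0 <= n ^+ 2 by rewrite sqr_ge0.
have nE : n ^+ 2 <= n ^+ 2 * E by rewrite ler_peMr.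
have B1 : `|expR a - 1 - a| <= n ^+ 2 * E.
  by apply: le_trans (abs_expRB1x_le _) _; rewrite mulrC ler_pM ?expR_ge0 ?mulr_ge0 ?sq.
have B2 : `|expR a * (cos b - 1)| <= n ^+ 2 * E.
  rewrite normrM mulrC ler_pM ?normr_ge0 //.
    by apply: le_trans (abs_cosB1_le _) _; rewrite sq.
  by rewrite ger0_norm ?expR_ge0 // ; apply: le_trans Ea; rewrite ler_expR ler_norm.
have B3 : `|(expR a - 1) * sin b| <= n ^+ 2 * E.
  rewrite normrM; apply: le_trans (ler_pM _ _ (abs_expRB1_le _) (abs_sin_le _)) _ => //.
  by rewrite -mulrA mulrC ler_pM ?expR_ge0 ?mulr_ge0 ?sq.
have B4 : `|sin b - b| <= 2 * (n ^+ 2 * E).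
  apply: le_trans (abs_sinB_le _) _; rewrite ler_wpM2l //.
  by apply: le_trans nE; rewrite sq.
have -> : expR a * cos b - 1 - a = (expR a - 1 - a) + expR a * (cos b - 1) by ring.
have -> : expR a * sin b - b = (expR a - 1) * sin b + (sin b - b) by ring.
have := ler_normD (expR a - 1 - a) (expR a * (cos b - 1)).
have := ler_normD ((expR a - 1) * sin b) (sin b - b).
by rewrite -!mulrA; nra.
Qed.

Lemma cdiff_cexp z : cdiff cexp z (cexp z).
Proof.
have D0 : forall e : R, 0 < e -> exists2 d : R, 0 < d & forall h, nc h < d ->
    nc (cexp h - 1 - h) <= e * nc h.
  move=> e e0; have K0 : 0 < 6 * expR 1 :> R by rewrite mulr_gt0 ?expR_gt0.
  exists (Num.min 1 (e / (6 * expR 1))) => [|h]; first by rewrite lt_min ltr01 divr_gt0.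
  rewrite lt_min => /andP[/ltW h1]; rewrite ltr_pdivlMr // => /ltW he.
  apply: le_trans (cexp_bound h) _.
  have -> : 6 * nc h ^+ 2 * expR (nc h) = (nc h * (6 * expR (nc h))) * nc h by ring.
  rewrite ler_wpM2r ?nc_ge0 //; apply: le_trans he.
  by rewrite ler_wpM2l ?nc_ge0 // ler_wpM2l // ler_expR.
move=> e e0.
have Z0 : 0 < nc (cexp z) + 1 by rewrite ltr_wpDl ?nc_ge0.
have [d d0 H] := D0 (e / (nc (cexp z) + 1)) (divr_gt0 e0 Z0).
exists d => // h /H {}H; rewrite cexpD.
have -> : cexp z * cexp h - cexp z - cexp z * h = cexp z * (cexp h - 1 - h) by ring.
rewrite ncM; apply: le_trans (ler_wpM2l (nc_ge0 _) H) _.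
by rewrite mulrA ler_wpM2r ?nc_ge0 // mul_div1_le ?nc_ge0 // ltW.
Qed.

Lemma cdiff_cexp_affine a b z : cdiff (fun w => cexp (a * w + b)) z (cexp (a * z + b) * a).
Proof. exact: (cdiff_comp (cdiff_cexp _) (cdiff_affine a b z)). Qed.

Lemma cdiff_cexpM a z : cdiff (fun w => cexp (a * w)) z (cexp (a * z) * a).
Proof.
have := cdiff_cexp_affine a 0 z; rewrite addr0.
by have -> : (fun w => cexp (a * w + 0)) = (fun w => cexp (a * w))
  by apply/funext => w; rewrite addr0.
Qed.

Lemma linear_ode (a : R[i]) u : (forall w, cdiff u w (a * u w)) -> forall w, u w = u 0 * cexp (a * w).
Proof.
move=> D w.
have D0 v : cdiff (fun v => u v * cexp (- a * v)) v 0.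
  have := cdiff_mul (D v) (cdiff_cexpM (- a) v).
  by have -> : a * u v * cexp (- a * v) + u v * (cexp (- a * v) * - a) = 0 by ring.
have := cderiv0_cst D0 w; rewrite mulr0 cexp0 mulr1 => <-.
by rewrite -mulrA -cexpD mulNr addNr cexp0 mulr1.
Qed.

End CExp.

(** * Hilbert spaces of functions *)

(* Neither definite nor complete, so that it also covers the square-integrable
   functions, which are not identified when equal almost everywhere. *)
Record is_prehilbert (R : realType) (H : fspace R) : Prop := IsPrehilbert {
  prehilbert_zero : carrier H (fun=> 0);
  prehilbert_lin_closed : forall (a : R[i]) (f g : R[i] -> R[i]),
    carrier H f -> carrier H g -> carrier H (fun z => a * f z + g z);
  prehilbert_inner_linear : forall (a : R[i]) (f g h : R[i] -> R[i]),
    carrier H f -> carrier H g -> carrier H h ->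
    inner H (fun z => a * f z + g z) h = a * inner H f h + inner H g h;
  prehilbert_inner_conj : forall f g : R[i] -> R[i],
    carrier H f -> carrier H g -> inner H g f = (inner H f g)^*;
  prehilbert_inner_ge0 : forall f : R[i] -> R[i],
    carrier H f -> 0 <= inner H f f }.

Lemma hilbert_prehilbert (R : realType) (H : fspace R) :
  is_hilbert H -> is_prehilbert H.
Proof. by case=> *; split. Qed.

Section PreHilbert.
Variables (R : realType) (H : fspace R).
Hypothesis pH : is_prehilbert H.
Implicit Types (f g h : R[i] -> R[i]) (a : R[i]).
Local Notation nc := Normc.normc.
Local Notation C := (carrier H).
Local Notation ip := (inner H).
Local Notation nrm := (hnorm H).

Lemma carrier0 : C (fun=> 0). Proof. exact: prehilbert_zero. Qed.
Lemma carrier_lin a f g : C f -> C g -> C (fun z => a * f z + g z).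
Proof. exact: prehilbert_lin_closed. Qed.

Lemma carrierD f g : C f -> C g -> C (fun z => f z + g z).
Proof.
move=> Cf Cg; have := carrier_lin 1 Cf Cg.
by under eq_fun do rewrite mul1r.
Qed.
Lemma carrierB f g : C f -> C g -> C (fun z => f z - g z).
Proof.
move=> Cf Cg; have := carrier_lin (-1) Cg Cf.
by under eq_fun do rewrite mulN1r addrC.
Qed.
Lemma carrierZ a f : C f -> C (fun z => a * f z).
Proof.
move=> Cf; have := carrier_lin a Cf carrier0.
by under eq_fun do rewrite addr0.
Qed.

Lemma inner_lin a f g h : C f -> C g -> C h ->
  ip (fun z => a * f z + g z) h = a * ip f h + ip g h.
Proof. exact: prehilbert_inner_linear. Qed.
Lemma inner_conj f g : C f -> C g -> ip g f = (ip f g)^*.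
Proof. exact: prehilbert_inner_conj. Qed.

Lemma inner0l h : C h -> ip (fun=> 0) h = 0.
Proof.
move=> Ch; have := inner_lin 1 carrier0 carrier0 Ch.
under eq_fun do rewrite mulr0 addr0.
by rewrite mul1r => /eqP; rewrite -subr_eq subrr => /eqP.
Qed.
Lemma innerDl f g h : C f -> C g -> C h -> ip (fun z => f z + g z) h = ip f h + ip g h.
Proof.
move=> Cf Cg Ch; have := inner_lin 1 Cf Cg Ch.
by under eq_fun do rewrite mul1r; rewrite mul1r.
Qed.
Lemma innerBl f g h : C f -> C g -> C h -> ip (fun z => f z - g z) h = ip f h - ip g h.
Proof.
move=> Cf Cg Ch; have := inner_lin (-1) Cg Cf Ch.
by under eq_fun do rewrite mulN1r addrC; rewrite mulN1r addrC.
Qed.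
Lemma innerZl a f h : C f -> C h -> ip (fun z => a * f z) h = a * ip f h.
Proof.
move=> Cf Ch; have := inner_lin a Cf carrier0 Ch.
by under eq_fun do rewrite addr0; rewrite inner0l // addr0.
Qed.
Lemma innerBr f g h : C f -> C g -> C h -> ip h (fun z => f z - g z) = ip h f - ip h g.
Proof.
move=> Cf Cg Ch; rewrite inner_conj ?innerBl ?rmorphB /= -?inner_conj //; exact: carrierB.
Qed.
Lemma innerDr f g h : C f -> C g -> C h -> ip h (fun z => f z + g z) = ip h f + ip h g.
Proof.
move=> Cf Cg Ch; rewrite inner_conj ?innerDl ?rmorphD /= -?inner_conj //; exact: carrierD.
Qed.
Lemma innerZr a f h : C f -> C h -> ip h (fun z => a * f z) = a^* * ip h f.
Proof.
move=> Cf Ch; rewrite inner_conj ?innerZl ?rmorphM /= -?inner_conj //; exact: carrierZ.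
Qed.

Lemma inner_self f : C f -> ip f f = (nrm f ^+ 2)%:C.
Proof.
move=> Cf; have := prehilbert_inner_ge0 pH Cf.
rewrite /hnorm; case: (ip f f) => x y; rewrite lecE /= => /andP[/eqP -> x0].
by rewrite sqr_sqrtr.
Qed.

Lemma hnorm_sq f : C f -> nrm f ^+ 2 = complex.Re (ip f f).
Proof. by move/inner_self ->. Qed.

Lemma hnorm_ge0 f : 0 <= nrm f. Proof. exact: sqrtr_ge0. Qed.

Lemma hnormZ a f : C f -> nrm (fun z => a * f z) = nc a * nrm f.
Proof.
move=> Cf; have Caf := carrierZ a Cf.
apply/eqP; rewrite -(eqrXn2 (n := 2)) ?hnorm_ge0 ?mulr_ge0 ?nc_ge0 ?hnorm_ge0 //.
rewrite hnorm_sq // innerZl // innerZr // inner_self // exprMn ncE.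
by case: a {Caf} => x y; apply/eqP => /=; ring.
Qed.

Lemma hnormN f : C f -> nrm (fun z => - f z) = nrm f.
Proof.
move=> Cf; have := hnormZ (-1) Cf; rewrite ncN nc1 mul1r => <-.
by congr hnorm; apply/funext => z; rewrite mulN1r.
Qed.

Lemma hnorm_subC f g : C f -> C g -> nrm (fun z => f z - g z) = nrm (fun z => g z - f z).
Proof.
move=> Cf Cg; rewrite -hnormN; last exact: carrierB.
by congr hnorm; apply/funext => z; rewrite opprB.
Qed.

Lemma hnormD_sq f g : C f -> C g ->
  nrm (fun z => f z + g z) ^+ 2 = nrm f ^+ 2 + 2 * complex.Re (ip f g) + nrm g ^+ 2.
Proof.
move=> Cf Cg; rewrite !hnorm_sq //; last exact: carrierD.
rewrite innerDl ?innerDr //; last exact: carrierD.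
rewrite (inner_conj Cf Cg).
by case: (ip f g) (ip f f) (ip g g) => [a b] [c d] [x y] /=; ring.
Qed.

Lemma hnormB_sq f g : C f -> C g ->
  nrm (fun z => f z - g z) ^+ 2 = nrm f ^+ 2 - 2 * complex.Re (ip f g) + nrm g ^+ 2.
Proof.
move=> Cf Cg; rewrite !hnorm_sq //; last exact: carrierB.
rewrite innerBl ?innerBr //; last exact: carrierB.
rewrite (inner_conj Cf Cg).
by case: (ip f g) (ip f f) (ip g g) => [a b] [c d] [x y] /=; ring.
Qed.

(** The form may be degenerate, so [nrm g = 0] is a case of its own. [P] expresses that f - t <f, g>
    g has a nonnegative square norm for every real t. *)
Lemma cauchy_schwarz f g : C f -> C g -> nc (ip f g) <= nrm f * nrm g.
Proof.
move=> Cf Cg; set N := nc (ip f g).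
have P (t : R) : 0 <= nrm f ^+ 2 - 2 * (t * N ^+ 2) + t ^+ 2 * N ^+ 2 * nrm g ^+ 2.
  pose a := t%:C * ip f g.
  have -> : t ^+ 2 * N ^+ 2 * nrm g ^+ 2 = nrm (fun z => a * g z) ^+ 2.
    by rewrite hnormZ // ncM ncR !exprMn real_normK ?num_real.
  have -> : t * N ^+ 2 = complex.Re (ip f (fun z => a * g z)).
    rewrite innerZr // /N ncE /a; case: (ip f g) => x y; simpc => /=; ring.
  by rewrite -hnormB_sq //; [exact: sqr_ge0 | exact: carrierZ].
have N0 : 0 <= N := nc_ge0 _.
rewrite -(ler_pXn2r (n := 2)) ?nnegrE ?mulr_ge0 ?hnorm_ge0 // exprMn.
have [g0|g0] := eqVneq (nrm g) 0.
  rewrite g0 expr0n mulr0.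
  have [//|N20] := leP (N ^+ 2) 0.
  (* With [nrm g = 0] the expression in [P] is affine in t, and this t makes it equal to -1. *)
  have := P ((nrm f ^+ 2 + 1) / (2 * N ^+ 2)).
  rewrite g0 expr0n mulr0 addr0.
  have -> : 2 * ((nrm f ^+ 2 + 1) / (2 * N ^+ 2) * N ^+ 2) = nrm f ^+ 2 + 1.
    by field; apply: contraTneq N20 => ->; rewrite expr0n ltxx.
  by rewrite opprD addrA subrr sub0r oppr_ge0 ler10.
have ng : 0 < nrm g ^+ 2 by rewrite exprn_gt0 // lt_def g0 hnorm_ge0.
have := P (nrm g ^+ 2)^-1.
have -> : nrm f ^+ 2 - 2 * ((nrm g ^+ 2)^-1 * N ^+ 2) + (nrm g ^+ 2)^-1 ^+ 2 * N ^+ 2 * nrm g ^+ 2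
  = nrm f ^+ 2 - N ^+ 2 / nrm g ^+ 2 by field.
by rewrite subr_ge0 ler_pdivrMr.
Qed.

Lemma hnormD f g : C f -> C g -> nrm (fun z => f z + g z) <= nrm f + nrm g.
Proof.
move=> Cf Cg.
rewrite -(ler_pXn2r (n := 2)) ?nnegrE ?addr_ge0 ?hnorm_ge0 // hnormD_sq // sqrrD lerD2r lerD2l.
rewrite mulr_natl lerMn2r /=; apply: le_trans (cauchy_schwarz Cf Cg).
exact: le_trans (ler_norm _) (Re_le_nc _).
Qed.

Lemma hnorm_triangle f g h : C f -> C g -> C h ->
  nrm (fun z => f z - h z) <= nrm (fun z => f z - g z) + nrm (fun z => g z - h z).
Proof.
move=> Cf Cg Ch; have := hnormD (carrierB Cf Cg) (carrierB Cg Ch).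
by under eq_fun do rewrite addrA subrK.
Qed.

Lemma hnorm0 : nrm (fun=> 0) = 0.
Proof. by rewrite /hnorm inner0l ?sqrtr0 //; exact: carrier0. Qed.

Lemma parallelogram f g : C f -> C g ->
  nrm (fun z => f z - g z) ^+ 2 + nrm (fun z => f z + g z) ^+ 2 = 2 * nrm f ^+ 2 + 2 * nrm g ^+ 2.
Proof. by move=> Cf Cg; rewrite hnormB_sq // hnormD_sq //; ring. Qed.

End PreHilbert.

(** * Consequences of completeness: projection, uniform boundedness, Riesz representation *)

Section Hilbert.
Variables (R : realType) (H : fspace R).
Hypothesis hH : is_hilbert H.
Let pH := hilbert_prehilbert hH.
Implicit Types (f g h : R[i] -> R[i]) (a : R[i]).
Local Notation nc := Normc.normc.
Local Notation C := (carrier H).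
Local Notation ip := (inner H).
Local Notation nrm := (hnorm H).

Lemma hilbert_cauchy (u : nat -> R[i] -> R[i]) : (forall n, C (u n)) ->
  (forall e : R, 0 < e -> exists N : nat, forall m n : nat,
       (N <= m)%N -> (N <= n)%N -> nrm (fun z => u m z - u n z) < e) ->
  exists2 f, C f & forall e : R, 0 < e -> exists N, forall n, (N <= n)%N ->
    nrm (fun z => u n z - f z) < e.
Proof.
move=> Cu cu; have [f Cf /cvgrPdist_lt cv] := hilbert_complete hH Cu cu.
exists f => // e e0; have [N _ HN] := cv e e0; exists N => n /HN /=.
by rewrite sub0r normrN ger0_norm // hnorm_ge0.
Qed.

Lemma inner_dist_le f g h : C f -> C g -> C h ->
  nc (ip f h) <= nrm (fun z => f z - g z) * nrm h + nc (ip g h).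
Proof.
move=> Cf Cg Ch; rewrite -[ip f h](subrK (ip g h)); apply: le_trans (ncD _ _) _.
rewrite lerD2r -(innerBl pH) //; apply: cauchy_schwarz => //; exact: carrierB.
Qed.

Lemma invSn_lt (e : R) : 0 < e -> exists N : nat, forall n, (N <= n)%N -> n.+1%:R^-1 < e.
Proof.
move=> e0; have [N _ HN] := near_infty_natSinv_lt (PosNum e0); exists N => n /HN //.
Qed.

(** [S] is a subspace that need not be closed, so the nearest point may lie outside it. Only the
    residual [u] is returned: it is orthogonal to [S] and is a limit of vectors f - s with s in
    [S]. *)
Lemma projection (S : set (R[i] -> R[i])) f :
  S `<=` C -> S (fun=> 0) ->
  (forall a g h, S g -> S h -> S (fun z => a * g z + h z)) -> C f ->
  exists2 u, C u & (forall s, S s -> ip u s = 0) /\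
   forall e : R, 0 < e -> exists2 s, S s & nrm (fun z => f z - s z - u z) < e.
Proof.
move=> SC S0 Sl Cf.
pose D := [set x | exists2 s, S s & x = nrm (fun z => f z - s z) ^+ 2].
have Dlb x : D x -> 0 <= x by case=> s _ ->; rewrite sqr_ge0.
have Dinf : has_inf D.
  by split; [exists (nrm (fun z => f z - 0) ^+ 2), (fun=> 0) | exists 0 => x /Dlb].
set d := inf D.
have dle s : S s -> d <= nrm (fun z => f z - s z) ^+ 2.
  by move=> Ss; apply: ge_inf; [case: Dinf | exists s].
have ex n : exists s, S s /\ nrm (fun z => f z - s z) ^+ 2 < d + n.+1%:R^-1.
  have n0 : 0 < n.+1%:R^-1 :> R by rewrite invr_gt0.
  by have [_ [s Ss ->] lt] := inf_adherent n0 Dinf; exists s.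
have [s Hs] := choice ex.
have Ss n : S (s n) by case: (Hs n).
pose u n z := f z - s n z.
have sle n : nrm (u n) ^+ 2 < d + n.+1%:R^-1 by case: (Hs n).
have Cu n : C (u n) by apply: (carrierB pH) => //; exact/SC.
(* The midpoint of [s m] and [s n] is again in [S], so its distance to [f] is at least the infimum;
   the parallelogram law then makes the minimizing sequence Cauchy. *)
have cau m n : nrm (fun z => u m z - u n z) ^+ 2 <= 2 * (m.+1%:R^-1 + n.+1%:R^-1).
  have := parallelogram pH (Cu m) (Cu n).
  have Smn : S (fun z => 2^-1 * s m z + (2^-1 * s n z + 0)) by do 2 apply: (Sl) => //.
  have : nrm (fun z => u m z + u n z) ^+ 2 = 4 * nrm (fun z => f z - (2^-1 * s m z + (2^-1 * s n z + 0))) ^+ 2.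
    have -> : (fun z => u m z + u n z) = (fun z => (2:R)%:C * (f z - (2^-1 * s m z + (2^-1 * s n z + 0)))).
      apply/funext => z; rewrite /u addr0 -mulrDr.
      by rewrite -[(2:R)%:C]/((1 + 1 : R)%:C) rmorphD /= rmorph1; field.
    rewrite (hnormZ pH); last by apply: (carrierB pH) => //; exact: SC.
    by rewrite ncR exprMn ger0_norm //; congr (_ * _); rewrite expr2 -natrM.
  move=> ->; have := dle _ Smn; have := sle m; have := sle n.
  by move: (m.+1%:R^-1) (n.+1%:R^-1) => p q; lra.
have [|v Cv cv] := hilbert_cauchy Cu.
  move=> e e0; have [|N HN] := @invSn_lt (e ^+ 2 / 4); first by rewrite divr_gt0 ?exprn_gt0.
  exists N => m n mN nN; rewrite -(ltr_pXn2r (n := 2)) ?nnegrE ?hnorm_ge0 ?(ltW e0) //.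
  by apply: le_lt_trans (cau m n) _; have := HN _ mN; have := HN _ nN; move: (m.+1%:R^-1) (n.+1%:R^-1) => p q; lra.
exists v => //; split; last first.
  move=> e /cv[N HN]; exists (s N) => //; exact: HN.
move=> t St; have Ct := SC _ St.
(* Moving [s n] by a multiple of [t] can lower the square distance by less than 1/(n+1). The
   multiple <u_n, t>/(|t|^2 + 1) lowers it by at least |<u_n, t>|^2/(|t|^2 + 1); the added 1 covers
   the case of a [t] of norm 0. *)
have un n : nc (ip (u n) t) ^+ 2 <= (nrm t ^+ 2 + 1) * n.+1%:R^-1.
  set N := nc _; pose r := (nrm t ^+ 2 + 1)^-1.
  have T0 : 0 < nrm t ^+ 2 + 1 by rewrite ltr_wpDl ?sqr_ge0.
  pose a := r%:C * ip (u n) t.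
  have : d <= nrm (fun z => u n z - a * t z) ^+ 2.
    have -> : (fun z => u n z - a * t z) = (fun z => f z - (a * t z + s n z)).
      by apply/funext => z; rewrite /u; ring.
    by apply: dle; apply: Sl.
  rewrite (hnormB_sq pH) //; last exact: (carrierZ pH).
  rewrite (hnormZ pH) // ncM ncR -/N.
  have -> : complex.Re (ip (u n) (fun z => a * t z)) = r * N ^+ 2.
    rewrite (innerZr pH) // /N ncE /a; case: (ip (u n) t) => x y; simpc => /=; ring.
  have := sle n.
  rewrite !exprMn real_normK ?num_real // => l1 l2.
  have r0 : 0 < r by rewrite invr_gt0.
  have rt : r * nrm t ^+ 2 <= 1.
    by rewrite /r mulrC ler_pdivrMr // mul1r lerDl.
  have N2 : 0 <= N ^+ 2 by rewrite sqr_ge0.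
  rewrite mulrC -ler_pdivrMr // -/r.
  have : r ^+ 2 * N ^+ 2 * nrm t ^+ 2 <= r * N ^+ 2.
    have -> : r ^+ 2 * N ^+ 2 * nrm t ^+ 2 = (r * N ^+ 2) * (r * nrm t ^+ 2) by ring.
    by rewrite ler_piMr // mulr_ge0 // ltW.
  rewrite [_ * r]mulrC; move: l1; move: (n.+1%:R^-1) => p l1. lra.
apply/eqP; rewrite -nc_eq0 eq_le nc_ge0 andbT; apply/ler_addgt0Pr => e e0; rewrite add0r.
have T0 : 0 < nrm t + 1 by rewrite ltr_wpDl ?hnorm_ge0.
have T20 : 0 < nrm t ^+ 2 + 1 by rewrite ltr_wpDl ?sqr_ge0.
have [N1 H1] := cv (e / 2 / (nrm t + 1)) ltac:(by rewrite !divr_gt0).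
have [N2 H2] := @invSn_lt ((e / 2) ^+ 2 / (nrm t ^+ 2 + 1)) ltac:(by rewrite !(divr_gt0, exprn_gt0)).
pose n := maxn N1 N2.
apply: le_trans (inner_dist_le Cv (Cu n) Ct) _; rewrite [e in _ <= e]splitr lerD //.
  rewrite (hnorm_subC pH) //; apply: le_trans (ler_wpM2r (hnorm_ge0 _ _) (ltW (H1 n _))) _.
    by rewrite leq_maxl.
  by rewrite mulrC mul_div1_le ?hnorm_ge0 // ltW // divr_gt0.
rewrite -(ler_pXn2r (n := 2)) ?nnegrE ?nc_ge0 //; last by rewrite ltW // divr_gt0.
apply: le_trans (un n) _; rewrite mulrC -ler_pdivlMr // ltW //; apply: H2.
by rewrite leq_maxr.
Qed.

(* Gliding hump without Baire: one of x + e_j, x - e_j pairs with v_j at least as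
   strongly as e_j does, and the steps 3^-j are too short to undo this later. *)
Lemma uniform_boundedness (v : nat -> R[i] -> R[i]) : (forall n, C (v n)) ->
  (forall f, C f -> exists M, forall n, nc (ip f (v n)) <= M) ->
  exists M, forall n, nrm (v n) <= M.
Proof.
move=> Cv bv; apply: contrapT => unb.
(* The factor 3^j pays for the length 3^-j of the j-th step; the factor j + 1 makes what remains
   unbounded. *)
have ex (j : nat) : exists n, 3 ^+ j * j.+1%:R < nrm (v n).
  apply: contrapT => nex; apply: unb; exists (3 ^+ j * j.+1%:R) => n.
  by rewrite leNgt; apply/negP => lt; apply: nex; exists n.
have [s Hs] := choice ex; pose w j := v (s j).
have Cw j : C (w j) by apply: Cv.
have wlt j : 3 ^+ j * j.+1%:R < nrm (w j) by apply: Hs.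
have w0 j : 0 < nrm (w j) by apply: lt_trans (wlt j); rewrite mulr_gt0 // exprn_gt0.
pose a j : R := 3 ^- j / nrm (w j).
have a0 j : 0 < a j by rewrite divr_gt0 // invr_gt0 exprn_gt0.
pose step j (x : R[i] -> R[i]) : R[i] -> R[i] :=
  if a j * nrm (w j) ^+ 2 <= nc (ip (fun z => x z + (a j)%:C * w j z) (w j))
  then fun z => x z + (a j)%:C * w j z else fun z => x z - (a j)%:C * w j z.
pose X := fix X n := if n is m.+1 then step m.+1 (X m) else (fun=> 0).
have Caw j : C (fun z => (a j)%:C * w j z) by apply: (carrierZ pH).
have CX n : C (X n).
  elim: n => [|n IH]; first exact: (carrier0 pH).
  by rewrite /= /step; case: ifP => _; [apply: (carrierD pH)|apply: (carrierB pH)].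
have aw j : nrm (fun z => (a j)%:C * w j z) = 3 ^- j.
  by rewrite (hnormZ pH) // ncR gtr0_norm // /a divfK // gt_eqF.
have dX n : nrm (fun z => X n.+1 z - X n z) = 3 ^- n.+1.
  rewrite -aw /= /step; case: ifP => _.
    by under eq_fun do rewrite addrC addKr.
  by rewrite -[RHS](hnormN pH) //; under eq_fun do rewrite addrC addKr.
have lX n : 3 ^- n.+1 * nrm (w n.+1) <= nc (ip (X n.+1) (w n.+1)).
  have -> : 3 ^- n.+1 * nrm (w n.+1) = a n.+1 * nrm (w n.+1) ^+ 2.
    by rewrite /a; field; rewrite gt_eqF //= gt_eqF // exprn_gt0.
  rewrite /= /step; case: ifPn => //; rewrite -ltNge.
  rewrite (innerDl pH) // (innerBl pH) // (innerZl pH) // (inner_self pH) // -rmorphM /=.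
  set y := ip _ _; set b := a _ * _; have b0 : 0 <= b by rewrite mulr_ge0 ?sqr_ge0 ?ltW.
  move=> lt; have : nc (b + b)%:C <= nc (y + b%:C) + nc (y - b%:C).
    rewrite [nc (y - _)]ncB.
    have -> : (b + b)%:C = (y + b%:C) + (b%:C - y) by rewrite rmorphD; ring.
    exact: ncD.
  by rewrite ncR ger0_norm ?addr_ge0 //; lra.
have geo j i : nrm (fun z => X (j + i)%N z - X j z) <= 3 ^- j / 2 * (1 - 3 ^- i).
  elim: i => [|i IH].
    rewrite addn0 expr0 invr1 subrr mulr0.
    by under eq_fun do rewrite subrr; rewrite (hnorm0 pH).
  apply: le_trans (hnorm_triangle pH (CX _) (CX (j + i)%N) (CX _)) _.
  rewrite addnS dX; apply: le_trans (lerD (lexx _) IH) _.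
  rewrite -addnS exprD invfM exprS invfM le_eqVlt; apply/orP; left; apply/eqP.
  by move: (3 ^- j) (3 ^- i) => p q; field.
have geo' j m : (j <= m)%N -> nrm (fun z => X m z - X j z) <= 3 ^- j / 2.
  move=> jm; rewrite -(subnKC jm); apply: le_trans (geo _ _) _.
  apply: ler_piMr; first by rewrite divr_ge0 // invr_ge0 exprn_ge0.
  by rewrite lerBlDr lerDl invr_ge0 exprn_ge0.
have p3 n : (n.+1%:R <= 3 ^+ n :> R).
  by rewrite -natrX ler_nat ltn_expl.
have [|x Cx cx] := hilbert_cauchy CX.
  move=> e e0; have [N HN] := invSn_lt e0; exists N => m n mN nN.
  apply: le_lt_trans (hnorm_triangle pH (CX _) (CX N) (CX _)) _.
  have g1 := geo' _ _ mN; have g2 := geo' _ _ nN; rewrite [X in _ + X](hnorm_subC pH) //.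
  have : 3 ^- N <= N.+1%:R^-1 :> R by rewrite lef_pV2 ?posrE ?exprn_gt0.
  move: g1 g2 (HN N (leqnn N)); move: (N.+1%:R^-1) (3 ^- N) => p q; lra.
have xX j : nrm (fun z => X j z - x z) <= 3 ^- j / 2.
  apply/ler_addgt0Pr => e /cx[N HN]; pose n := maxn N j.
  apply: le_trans (hnorm_triangle pH (CX _) (CX n) Cx) _; apply: lerD.
    by rewrite (hnorm_subC pH) //; apply: geo'; rewrite leq_maxr.
  by apply/ltW/HN; rewrite leq_maxl.
have [M HM] := bv _ Cx.
(* All steps after j + 1 together have length at most half of 3^-(j+1), so they cancel at most half
   of the lower bound in [lX]. By the choice of [w], the other half is at least (j + 2)/2. *)
have grow j : j.+2%:R / 2 <= M.
  apply: le_trans (HM (s j.+1)); rewrite -/(w j.+1).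
  have := inner_dist_le (CX j.+1) Cx (Cw j.+1).
  have l1 := ler_wpM2r (hnorm_ge0 H (w j.+1)) (xX j.+1).
  have l2 := lX j.
  have : j.+2%:R <= 3 ^- j.+1 * nrm (w j.+1).
    by rewrite mulrC ler_pdivlMr ?exprn_gt0 // mulrC ltW.
  move: l1 l2; set p := 3 ^- _; set q := nrm (w _); set r := nrm _.
  by rewrite [p / 2 * q]mulrAC; move: (p * q) => t; lra.
have := archi_boundP (le_trans (ltac:(by rewrite divr_ge0) : 0 <= 2%:R / 2 :> R) (grow 0%N)).
set k := Num.bound _ => Mk; have := grow (2 * k)%N.
by rewrite -addn2 natrD natrM; move: Mk; set kk := k%:R; lra.
Qed.

Lemma riesz (L : (R[i] -> R[i]) -> R[i]) (M : R) :
  (forall a f g, C f -> C g -> L (fun z => a * f z + g z) = a * L f + L g) ->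
  (forall f, C f -> nc (L f) <= M * nrm f) ->
  exists2 h, C h & forall f, C f -> L f = ip f h.
Proof.
move=> Ll Lb.
have [L0|] := pselect (forall f, C f -> L f = 0).
  exists (fun=> 0) => [|f Cf]; first exact: (carrier0 pH).
  by rewrite L0 // (inner_conj pH (carrier0 pH)) // (inner0l pH) //; exact/esym/conjc0.
move/existsNP => [f0 /not_implyP[Cf0 /eqP Lf0]].
have L0 : L (fun=> 0) = 0.
  apply/eqP; rewrite -nc_eq0 eq_le nc_ge0 andbT.
  by have := Lb _ (carrier0 pH); rewrite (hnorm0 pH) mulr0.
pose S := [set s | C s /\ L s = 0].
have [||| u Cu [uS ue]] := @projection S f0 _ _ _ Cf0.
- by move=> s [].
- by split => //; exact: (carrier0 pH).
- move=> a g h [Cg g0] [Ch h0]; split; first exact: (carrier_lin pH).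
  by rewrite Ll // g0 h0 mulr0 addr0.
have LB f g : C f -> C g -> L (fun z => f z - g z) = L f - L g.
  move=> Cf Cg; have := Ll (-1) _ _ Cg Cf.
  by under eq_fun do rewrite mulN1r addrC; rewrite mulN1r addrC.
(* [u] is a limit of vectors f0 - s with L s = 0, so the bound on [L] suffices. [M] may be zero or
   negative, hence [|M| + 1] in the tolerance. *)
have Lu : L u = L f0.
  apply/eqP; rewrite eq_sym -subr_eq0 -nc_eq0 eq_le nc_ge0 andbT.
  apply/ler_addgt0Pr => e e0; rewrite add0r.
  have M0 : 0 < `|M| + 1 by rewrite ltr_wpDl.
  have [s [Cs s0] lt] := ue (e / (`|M| + 1)) (divr_gt0 e0 M0).
  have Cfs : C (fun z => f0 z - s z) by exact: (carrierB pH).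
  have := Lb _ (carrierB pH Cfs Cu); rewrite LB // LB // s0 subr0 => /le_trans; apply.
  apply: (@le_trans _ _ (`|M| * (e / (`|M| + 1)))); last by rewrite mul_div1_le // ltW.
  apply: (@le_trans _ _ (`|M| * nrm (fun z => f0 z - s z - u z))).
    by rewrite ler_wpM2r ?hnorm_ge0 // ler_norm.
  by rewrite ler_wpM2l // ltW.
have Lu0 : L u != 0 by rewrite Lu.
have u0 : nrm u ^+ 2 != 0.
  apply: contraNneq Lu0 => /eqP; rewrite sqrf_eq0 => /eqP u0.
  by rewrite -nc_eq0 eq_le nc_ge0 andbT; have := Lb _ Cu; rewrite u0 mulr0.
have uC : (nrm u ^+ 2)%:C != 0 :> R[i] by rewrite eq_complex /= negb_and u0.
exists (fun z => (L u / (nrm u ^+ 2)%:C)^* * u z) => [|f Cf]; first exact: (carrierZ pH).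
rewrite (innerZr pH) // conjCK.
(* This combination of [f] and [u] is annihilated by [L], hence orthogonal to [u]; solving that
   relation for L f gives the representer. *)
have Sg : S (fun z => L u * f z + (- L f * u z)).
  split; first by apply: (carrier_lin pH) => //; exact: (carrierZ pH).
  have LZ : L (fun z => - L f * u z) = - L f * L u.
    have := Ll (- L f) _ _ Cu (carrier0 pH).
    by under eq_fun do rewrite addr0; rewrite L0 addr0.
  by rewrite Ll //; [rewrite LZ; ring | exact: (carrierZ pH)].
have := uS _ Sg; rewrite (inner_conj pH) //; last by case: Sg.
move/eqP; rewrite conjC_eq0 (inner_lin pH) ?(innerZl pH) //; last exact: (carrierZ pH).
rewrite (inner_self pH) // mulNr subr_eq0 => /eqP e.
by rewrite mulrAC e mulfK.
Qed.

(** For f in the domain close to g, <g, g> = <g - f, g> is small. This is what makes the adjoint of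
    a densely defined operator single-valued. *)
Lemma dense_orthogonal (T : operator R) g : densely_defined H T ->
  op_dom T `<=` C -> C g -> (forall f, op_dom T f -> ip f g = 0) -> g = (fun=> 0).
Proof.
move=> dT TC Cg g0; apply: (hilbert_inner_def hH) => //.
apply/eqP; rewrite -nc_eq0 eq_le nc_ge0 andbT; apply/ler_addgt0Pr => e e0; rewrite add0r.
have G0 : 0 < nrm g + 1 by rewrite ltr_wpDl ?hnorm_ge0.
have [f Tf lt] := dT g _ Cg (divr_gt0 e0 G0).
apply: le_trans (inner_dist_le Cg (TC _ Tf) Cg) _; rewrite g0 // nc0 addr0 mulrC.
apply: le_trans (mul_div1_le (hnorm_ge0 H g) (ltW e0)).
by rewrite ler_wpM2l ?hnorm_ge0 // ltW.
Qed.

End Hilbert.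

(** * Reproducing kernels *)

Section RKHS.
Variables (R : realType) (H : fspace R) (k : R[i] -> R[i] -> R[i]).
Hypothesis rk : rkhs H k.
Let hH : is_hilbert H := rk.1.
Let pH := hilbert_prehilbert hH.
Implicit Types (f g h : R[i] -> R[i]) (a z w : R[i]).
Local Notation nc := Normc.normc.
Local Notation C := (carrier H).
Local Notation ip := (inner H).
Local Notation nrm := (hnorm H).

Lemma kernel_carrier w : C (k^~ w). Proof. by case: (rk.2 w). Qed.

Lemma reproducing f w : C f -> ip f (k^~ w) = f w.
Proof. by case: (rk.2 w) => _; apply. Qed.

Lemma kernel_conj z w : k z w = (k w z)^*.
Proof.
by rewrite -(reproducing z (kernel_carrier w)) (inner_conj pH) ?reproducing //;
  exact: kernel_carrier.
Qed.

Lemma kernel_spanW w : kernel_span k (k^~ w).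
Proof.
exists 1%N, (fun=> 1), (fun=> w); apply/funext => z.
by rewrite big_ord_recl big_ord0 addr0 mul1r.
Qed.

Lemma kernel_span0 : kernel_span k (fun=> 0).
Proof. by exists 0%N, (fun=> 0), (fun=> 0); apply/funext => z; rewrite big_ord0. Qed.

Lemma kernel_span_lin a f g : kernel_span k f -> kernel_span k g ->
  kernel_span k (fun z => a * f z + g z).
Proof.
move=> [n [b [w ->]]] [m [c [v ->]]].
exists (n + m)%N, (fun i => match fintype.split i with inl j => a * b j | inr j => c j end),
  (fun i => match fintype.split i with inl j => w j | inr j => v j end).
apply/funext => z; rewrite big_split_ord /=; congr (_ + _).
  rewrite big_distrr /=; apply: eq_bigr => i _.
  by rewrite (unsplitK (inl i)) mulrA.
by apply: eq_bigr => i _; rewrite (unsplitK (inr i)).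
Qed.

Lemma kernel_span_ind (P : (R[i] -> R[i]) -> Prop) : P (fun=> 0) ->
  (forall a w f, kernel_span k f -> P f -> P (fun z => a * k z w + f z)) ->
  forall f, kernel_span k f -> P f.
Proof.
move=> P0 PS f [n]; elim: n f => [|n IH] f [a [w ->]].
  by under eq_fun do rewrite big_ord0.
under eq_fun do rewrite big_ord_recl.
apply: PS; first by exists n, (fun i => a (lift ord0 i)), (fun i => w (lift ord0 i)).
by apply: IH; exists (fun i => a (lift ord0 i)), (fun i => w (lift ord0 i)).
Qed.

Lemma kernel_span_carrier : kernel_span k `<=` C.
Proof.
apply: kernel_span_ind; first exact: (carrier0 pH).
by move=> a w f _ Cf; apply: (carrier_lin pH) => //; exact: kernel_carrier.
Qed.

(** The residual of the projection onto the span is orthogonal to every k_w, so by the reproducing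
    property all its values are 0. *)
Lemma kernel_span_dense f (e : R) : C f -> 0 < e ->
  exists2 g, kernel_span k g & nrm (fun z => f z - g z) < e.
Proof.
move=> Cf e0; have [u Cu [u0 ue]] := projection hH kernel_span_carrier kernel_span0 kernel_span_lin Cf.
have uE : u = (fun=> 0).
  by apply/funext => w; rewrite -reproducing // u0 //; exact: kernel_spanW.
have [s Ss lt] := ue e e0; exists s => //.
by move: lt; rewrite uE; under eq_fun do rewrite subr0.
Qed.

Hypothesis Hent : C `<=` @entire R.

Lemma carrier_cdiff f w : C f -> cdiff f w (cderiv f w).
Proof. by move=> /Hent fe; apply: derivable_cdiff; exact: fe. Qed.

Lemma deriv_representer w : exists2 h, C h & forall f, C f -> cderiv f w = ip f h.
Proof.
(* Real increments suffice because the complex derivative exists, and they are unaffected by the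
   conjugation in the second argument of the inner product. *)
pose s n : R := n.+1%:R^-1.
have s0 n : 0 < s n by rewrite invr_gt0.
have sC n : (s n)%:C != 0 :> R[i] by rewrite eq_complex /= negb_and gt_eqF.
pose v n z := ((s n)%:C)^-1 * (k z (w + (s n)%:C) - k z w).
have Cv n : C (v n) by apply: (carrierZ pH); apply: (carrierB pH); exact: kernel_carrier.
have ipv f n : C f -> ip f (v n) = (f (w + (s n)%:C) - f w) / (s n)%:C.
  move=> Cf; rewrite (innerZr pH) //; last by apply: (carrierB pH); exact: kernel_carrier.
  rewrite (innerBr pH) ?reproducing //; try exact: kernel_carrier.
  by rewrite mulrC; congr (_ * _); rewrite fmorphV /=; congr (_^-1); exact: conjc_real.
have cv f (e : R) : C f -> 0 < e -> exists N, forall n, (N <= n)%N -> nc (cderiv f w - ip f (v n)) <= e.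
  move=> Cf e0; have [d d0 Hd] := carrier_cdiff w Cf e0.
  have [N HN] := invSn_lt d0; exists N => n nN.
  have nS : nc (s n)%:C = s n by rewrite ncR gtr0_norm.
  have := Hd (s n)%:C; rewrite nS => /(_ (HN _ nN)).
  have -> : f (w + (s n)%:C) - f w - cderiv f w * (s n)%:C =
     - ((cderiv f w - ip f (v n)) * (s n)%:C) by rewrite ipv //; field; exact: sC.
  by rewrite ncN ncM nS ler_pM2r.
have [M HM] : exists M, forall n, nrm (v n) <= M.
  apply: (uniform_boundedness hH Cv) => f Cf.
  have [N HN] := cv f 1 Cf ltr01.
  have S0 : 0 <= \sum_(i < N) nc (ip f (v i)) by apply: sumr_ge0 => i _; exact: nc_ge0.
  exists (\sum_(i < N) nc (ip f (v i)) + (nc (cderiv f w) + 1)) => n.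
  have [nN|nN] := ltnP n N.
    rewrite (bigD1 (Ordinal nN)) //= -addrA lerDl addr_ge0 ?addr_ge0 ?nc_ge0 //.
    by apply: sumr_ge0 => i _; exact: nc_ge0.
  rewrite -[leLHS]add0r lerD //.
  rewrite -{1}(subrK (cderiv f w) (ip f (v n))) addrC; apply: le_trans (ncD _ _) _.
  by rewrite lerD2l ncB HN.
apply: (@riesz _ _ hH _ M) => [a f g Cf Cg|f Cf].
  by apply: cdiff_cderiv; apply: cdiff_lin; exact: carrier_cdiff.
apply/ler_addgt0Pr => e e0; have [N HN] := cv f e Cf e0.
rewrite -(subrK (ip f (v N)) (cderiv f w)) addrC; apply: le_trans (ncD _ _) _.
apply: lerD; last exact: HN.
apply: le_trans (cauchy_schwarz pH Cf (Cv N)) _.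
by rewrite mulrC ler_wpM2r ?hnorm_ge0.
Qed.

Lemma kernel_of_adjoint_deriv : nonzero_space H -> densely_defined H (diff_op H) ->
  op_eq_on (adjoint H (diff_op H)) (mul_op H) (kernel_span k) ->
  exists c : R, 0 < c /\ forall z w : R[i], k z w = c%:C * cexp (z * w^*).
Proof.
move=> [f0 [Cf0 f00]] dd [domA domM eqAM].
have domC : op_dom (diff_op H) `<=` C by move=> f [].
have D z w : cdiff (k^~ z) w (z^* * k w z).
  pose q y := y * k y w.
  have Cq : C q by have [] := domM _ (kernel_spanW w).
  have adj f : op_dom (diff_op H) f -> cderiv f w = ip f q.
    move=> df; have Cdf : C (cderiv f) by case: df.
    have [_ [p Hp]] := domA _ (kernel_spanW w).
    have := eqAM _ (kernel_spanW w); rewrite /= -/q => qE.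
    have [_ /(_ f df)] : adjoint_image H (diff_op H) (k^~ w) q.
      by rewrite -qE; exact: (xgetPex _ (ex_intro _ p Hp)).
    by rewrite reproducing.
  (* [adj] cannot be applied to k_z, which may lie outside the domain. The representer [h] works on
     all of H and agrees with [q] on the dense domain, so h = q. *)
  have [h Ch hE] := deriv_representer w.
  have qh : (fun z => q z - h z) = (fun=> 0).
    apply: (dense_orthogonal hH dd domC); first exact: (carrierB pH).
    move=> f df; have Cf := domC _ df.
    by rewrite (innerBr pH) // -adj // hE // subrr.
  have -> : z^* * k w z = cderiv (k^~ z) w.
    rewrite hE; last exact: kernel_carrier.
    have -> : h = q by apply/funext => y; have /(congr1 (@^~ y)) /eqP := qh; rewrite subr_eq0 => /eqP.
    rewrite (inner_conj pH Cq (kernel_carrier z)) reproducing // /q rmorphM /=.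
    by rewrite (kernel_conj w z).
  exact: carrier_cdiff (kernel_carrier z).
have kE z w : k w z = k 0 z * cexp (z^* * w) by exact: (linear_ode (D z)).
(* The solution formula with parameter 0 shows that k_0 is constant; by Hermitian symmetry k(0, z)
   is then the same constant for every z. *)
have k0 z : k z 0 = k 0 0.
  by rewrite kE rmorph0 mul0r cexp0 mulr1.
have kE' z w : k z w = k 0 0 * cexp (z * w^*).
  rewrite kE [w^* * z]mulrC; congr (_ * _).
  by rewrite (kernel_conj 0 w) (kernel_conj 0 0) (k0 w).
have c0 : k 0 0 = (nrm (k^~ 0) ^+ 2)%:C.
  by rewrite -(inner_self pH) ?reproducing //; exact: kernel_carrier.
exists (nrm (k^~ 0) ^+ 2); split; last by move=> z w; rewrite kE' c0.
(* If the constant were 0, every kernel function and therefore every element of H would vanish. *)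
rewrite lt_def sqr_ge0 andbT; apply/eqP => n0; apply: f00.
apply/funext => w; rewrite -reproducing //.
have -> : k^~ w = (fun=> 0) by apply/funext => z; rewrite kE' c0 n0 mul0r.
by rewrite (inner_conj pH (carrier0 pH)) // (inner0l pH) //; exact: conjc0.
Qed.

(** The representer h of f |-> f'(w) is found by evaluation: h(z) = <h, k_z> is the conjugate of the
    derivative of k_z at w, which is z k(z, w). In particular z k_w lies in H without any growth
    estimate. *)
Lemma mul_adjoint_deriv : densely_defined H (diff_op H) ->
  (forall z w, cderiv (k^~ z) w = z^* * k w z) ->
  op_eq_on (adjoint H (diff_op H)) (mul_op H) (kernel_span k).
Proof.
move=> dd D.
have domC : op_dom (diff_op H) `<=` C by move=> f [].
have zk w : C (fun z => z * k z w) /\ forall f, C f -> cderiv f w = ip f (fun z => z * k z w).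
  have [h Ch hE] := deriv_representer w.
  have <- : h = (fun z => z * k z w) => //.
  apply/funext => z; rewrite -reproducing // (inner_conj pH (kernel_carrier z)) //.
  by rewrite -hE ?D ?rmorphM /= ?conjCK -?kernel_conj //; exact: kernel_carrier.
have span f : kernel_span k f ->
    adjoint_image H (diff_op H) f (fun z => z * f z).
  move: f; apply: kernel_span_ind.
    have -> : (fun z : R[i] => z * 0) = (fun=> 0) by apply/funext => z; rewrite mulr0.
    split; first exact: (carrier0 pH).
    move=> f [Cf Cdf].
    by rewrite !(inner_conj pH (carrier0 pH)) // !(inner0l pH).
  move=> a w f /kernel_span_carrier Cf [Czf Hf]; have [Czk Hk] := zk w.
  have eqf : (fun z => z * (a * k z w + f z)) = (fun z => a * (z * k z w) + z * f z).
    by apply/funext => z; ring.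
  rewrite /adjoint_image /= eqf; split; first exact: (carrier_lin pH).
  move=> g [Cg Cdg].
  rewrite (innerDr pH (carrierZ pH a (kernel_carrier w)) Cf) // (innerZr pH _ (kernel_carrier w)) //.
  rewrite (innerDr pH (carrierZ pH a Czk) Czf) // (innerZr pH _ Czk) //.
  by rewrite reproducing // Hk // -Hf.
split=> [f kf|f kf|f kf].
- by split; [exact: kernel_span_carrier | exists (fun z => z * f z); exact: span].
- by split; [exact: kernel_span_carrier | have [] := span f kf].
- rewrite /=; apply: xget_unique; first exact: span.
  move=> h [Ch Hh]; have [Cz Hz] := span f kf.
  have : (fun z => h z - z * f z) = (fun=> 0).
    apply: (dense_orthogonal hH dd domC); first exact: (carrierB pH).
    by move=> g dg; have Cg := domC _ dg; rewrite (innerBr pH) // -Hh // -Hz // subrr.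
  by move=> hz; apply/funext => z; have /(congr1 (@^~ z))/eqP := hz; rewrite subr_eq0 => /eqP.
Qed.

End RKHS.

(** * Goursat's theorem and the mean value property *)

Section SegmentIntegral.
Variable R : realType.
Implicit Types (a b m K : R) (g h : R -> R).

Definition segint a b g : R := Rintegral (@lebesgue_measure R) `[a, b] g.

Lemma segint_integrable a b g : continuous g ->
  (@lebesgue_measure R).-integrable `[a, b] (EFin \o g).
Proof.
move=> cg; apply: continuous_compact_integrable; first exact: segment_compact.
exact: continuous_subspaceT.
Qed.

Lemma segintS a b m g : continuous g -> a <= m -> m <= b ->
  segint a b g = segint a m g + segint m b g.
Proof.
move=> cg am mb; have := @Rintegral_itvB R g (BLeft a) (BRight b) m (segint_integrable a b cg).
rewrite !bnd_simp => /(_ am mb) H.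
rewrite /segint -(@Rintegral_itv_obnd_cbnd _ m) -?H; first by rewrite addrC subrK.
apply: integrableS (segint_integrable m b cg) => //.
by apply: subset_itvr; rewrite bnd_simp.
Qed.

Lemma segintD a b g h : continuous g -> continuous h ->
  segint a b (fun x => g x + h x) = segint a b g + segint a b h.
Proof. by move=> cg ch; rewrite /segint RintegralD //; exact: segint_integrable. Qed.

Lemma segintB a b g h : continuous g -> continuous h ->
  segint a b (fun x => g x - h x) = segint a b g - segint a b h.
Proof. by move=> cg ch; rewrite /segint RintegralB //; exact: segint_integrable. Qed.

Lemma segint_cst a b (r : R) : a <= b -> segint a b (fun=> r) = r * (b - a).
Proof.
move=> ab; rewrite /segint Rintegral_cst //; congr (_ * _).
transitivity (fine (@lebesgue_measure R [set` `[a, b]])); first by [].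
rewrite lebesgue_measure_itv /= lte_fin.
by case: ltgtP ab => // -> _; rewrite subrr.
Qed.

Lemma segint_bound a b g (r K : R) : continuous g -> a <= b ->
  (forall x, a <= x <= b -> `|g x - r| <= K) -> `|segint a b g - r * (b - a)| <= K * (b - a).
Proof.
move=> cg ab B; have cr : continuous (fun _ : R => r) by move=> ?; exact: cvg_cst.
have cK : continuous (fun _ : R => K) by move=> ?; exact: cvg_cst.
have cgr : continuous (fun x => g x - r) by move=> x; apply: cvgB; [exact: cg|exact: cvg_cst].
rewrite -!segint_cst // -segintB //; apply: le_trans (le_normr_Rintegral _ _) _ => //.
  exact: segint_integrable.
apply: le_Rintegral => //.
- by apply: (@segint_integrable a b (fun x => `|g x - r|)) => x; apply: cvg_norm; exact: cgr.
- exact: segint_integrable.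
Qed.

End SegmentIntegral.

Section Goursat.
Variable R : realType.
Implicit Types (z w l : R[i]) (a b c d : R).
Local Notation nc := Normc.normc.

Variable F : R[i] -> R[i].
Hypothesis dF : forall z, exists l, cdiff F z l.

Local Notation U x y := (complex.Re (F (x +i* y))).
Local Notation V x y := (complex.Im (F (x +i* y))).

Lemma ReB z w : complex.Re (z - w) = complex.Re z - complex.Re w.
Proof. by case: z w => ? ? []. Qed.
Lemma ImB z w : complex.Im (z - w) = complex.Im z - complex.Im w.
Proof. by case: z w => ? ? []. Qed.

Lemma holo_path_continuous (p : R -> R[i]) (q : R[i] -> R) :
  (forall x y, nc (p x - p y) <= `|x - y|) ->
  (forall z w, `|q z - q w| <= nc (z - w)) -> continuous (fun x => q (F (p x))).
Proof.
move=> Lp Lq x; apply/cvgrPdist_lt => e e0.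
have [l D] := dF (p x); have [d d0 Hd] := cdiff_cont D e0.
near=> y; rewrite distrC; apply: le_lt_trans (Lq _ _) _.
have -> : p y = p x + (p y - p x) by rewrite addrC subrK.
apply: Hd; apply: le_lt_trans (Lp _ _) _.
by rewrite distrC; near: y; apply: cvgr_dist_lt.
Unshelve. all: by end_near. Qed.

Lemma Re_lip z w : `|complex.Re z - complex.Re w| <= nc (z - w).
Proof. by rewrite -ReB Re_le_nc. Qed.
Lemma Im_lip z w : `|complex.Im z - complex.Im w| <= nc (z - w).
Proof. by rewrite -ImB Im_le_nc. Qed.

Lemma horizontal_lip c (x y : R) : nc ((x +i* c) - (y +i* c)) <= `|x - y|.
Proof. by apply: le_trans (nc_le_ReIm _) _; rewrite /= subrr normr0 addr0. Qed.
Lemma vertical_lip a (x y : R) : nc ((a +i* x) - (a +i* y)) <= `|x - y|.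
Proof. by apply: le_trans (nc_le_ReIm _) _; rewrite /= subrr normr0 add0r. Qed.

Lemma V_cont c : continuous (fun x => V x c).
Proof. apply: (holo_path_continuous (p := fun x => x +i* c)); [exact: horizontal_lip|exact: Im_lip]. Qed.
Lemma U_cont a : continuous (fun y => U a y).
Proof. apply: (holo_path_continuous (p := fun y => a +i* y)); [exact: vertical_lip|exact: Re_lip]. Qed.

Lemma continuous_sub (g h : R -> R) : continuous g -> continuous h -> continuous (fun x => g x - h x).
Proof. by move=> cg ch x; apply: cvgB; [exact: cg | exact: ch]. Qed.

(* The imaginary part of the integral of F over the boundary of a rectangle. *)
Definition rect_integral a b c d : R :=
  segint a b (fun x => V x c - V x d) + segint c d (fun y => U b y - U a y).

Let cV c d : continuous (fun x => V x c - V x d) := continuous_sub (@V_cont c) (@V_cont d).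
Let cU a b : continuous (fun y => U b y - U a y) := continuous_sub (@U_cont b) (@U_cont a).

Lemma rect_splitx a m b c d : a <= m -> m <= b ->
  rect_integral a b c d = rect_integral a m c d + rect_integral m b c d.
Proof.
move=> am mb; rewrite /rect_integral (segintS (@cV c d) am mb).
have -> : (fun y => U b y - U a y) = (fun y => (U m y - U a y) + (U b y - U m y)).
  by apply/funext => y; ring.
by rewrite segintD; [ring | exact: cU | exact: cU].
Qed.

Lemma rect_splity a b c m d : c <= m -> m <= d ->
  rect_integral a b c d = rect_integral a b c m + rect_integral a b m d.
Proof.
move=> cm md; rewrite /rect_integral (segintS (@cU a b) cm md).
have -> : (fun x => V x c - V x d) = (fun x => (V x c - V x m) + (V x m - V x d)).
  by apply/funext => y; ring.
by rewrite segintD; [ring | exact: cV | exact: cV].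
Qed.

(** The affine part of F contributes nothing: its terms on the two pairs of sides cancel. The
    remainder is at most e s in modulus, s being the sum of the two side lengths, so differences
    between opposite sides are at most 2 e s, and integrating gives 2 e s^2. *)
Lemma rect_small (x0 y0 : R) (e : R) : 0 < e -> exists2 dl : R, 0 < dl &
  forall a b c d, a <= x0 <= b -> c <= y0 <= d -> (b - a) + (d - c) < dl ->
  `|rect_integral a b c d| <= 2 * e * ((b - a) + (d - c)) ^+ 2.
Proof.
move=> e0; have [l D] := dF (x0 +i* y0); have [dl dl0 Hd] := D _ e0.
exists dl => // a b c d /andP[ax xb] /andP[cy yd]; set s := b - a + (d - c) => sd.
have ab : a <= b := le_trans ax xb; have cd : c <= d := le_trans cy yd.
pose E z := F z - F (x0 +i* y0) - l * (z - (x0 +i* y0)).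
have EB x y : a <= x <= b -> c <= y <= d -> nc (E (x +i* y)) <= e * s.
  move=> /andP[ax' xb'] /andP[cy' yd'].
  have le1 : nc ((x +i* y) - (x0 +i* y0)) <= s.
    apply: le_trans (nc_le_ReIm _) _; rewrite /s; apply: lerD; rewrite /= ler_norml; lra.
  have := Hd ((x +i* y) - (x0 +i* y0)) (le_lt_trans le1 sd).
  rewrite [(x0 +i* y0) + _]addrC subrK => /le_trans; apply.
  by rewrite ler_wpM2l // ltW.
have FE z w : F z - F w = E z - E w + l * (z - w) by rewrite /E; ring.
have hV x : a <= x <= b -> `|V x c - V x d - (c - d) * complex.Re l| <= 2 * (e * s).
  move=> xab; have e1 := EB x c xab; have e2 := EB x d xab.
  have -> : V x c - V x d - (c - d) * complex.Re l = complex.Im (E (x +i* c) - E (x +i* d)).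
    rewrite -ImB FE; case: (l) (E (x +i* c)) (E (x +i* d)) => ? ? [? ?] [? ?] /=; ring.
  apply: le_trans (Im_le_nc _) _; apply: le_trans (ncD _ _) _; rewrite ncN mulr_natl mulr2n.
  by apply: lerD; [apply: e1|apply: e2]; rewrite lexx ?cd.
have hU y : c <= y <= d -> `|U b y - U a y - (b - a) * complex.Re l| <= 2 * (e * s).
  move=> ycd; have e1 := EB b y _ ycd; have e2 := EB a y _ ycd.
  have -> : U b y - U a y - (b - a) * complex.Re l = complex.Re (E (b +i* y) - E (a +i* y)).
    rewrite -ReB FE; case: (l) (E (b +i* y)) (E (a +i* y)) => ? ? [? ?] [? ?] /=; ring.
  apply: le_trans (Re_le_nc _) _; apply: le_trans (ncD _ _) _; rewrite ncN mulr_natl mulr2n.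
  by apply: lerD; [apply: e1|apply: e2]; rewrite lexx ?ab.
have := segint_bound (@cV c d) ab hV; have := segint_bound (@cU a b) cd hU.
have -> : rect_integral a b c d = (segint a b (fun x => V x c - V x d) - (c - d) * complex.Re l * (b - a))
   + (segint c d (fun y => U b y - U a y) - (b - a) * complex.Re l * (d - c)) by rewrite /rect_integral; ring.
set p := _ - _ ; set q := _ - _ => hp hq.
apply: le_trans (ler_normD _ _) _; apply: le_trans (lerD hq hp) _.
by rewrite -mulrDr -/s le_eqVlt; apply/orP; left; apply/eqP; ring.
Qed.

(** Of four quarters one keeps at least a quarter of the integral, while s^2 in [rect_small] is
    divided by exactly four; at the common point of the nested rectangles these two rates contradict
    each other for small e. *)
Lemma goursat a b c d : a <= b -> c <= d -> rect_integral a b c d = 0.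
Proof.
move=> ab cd; apply/eqP; apply: contraT; rewrite -normr_gt0; set eta := `|_| => eta0.
pose s n : R := (b - a) / 2 ^+ n; pose t n : R := (d - c) / 2 ^+ n.
have s0 n : 0 <= s n by rewrite divr_ge0 ?subr_ge0 // exprn_ge0.
have t0 n : 0 <= t n by rewrite divr_ge0 ?subr_ge0 // exprn_ge0.
have two0 : 2 != 0 :> R by [].
have sS n : s n = s n.+1 + s n.+1 by rewrite /s exprS; field; rewrite expf_neq0.
have tS n : t n = t n.+1 + t n.+1 by rewrite /t exprS; field; rewrite expf_neq0.
pose bad n (p : R * R) := eta / 4 ^+ n <= `|rect_integral p.1 (p.1 + s n) p.2 (p.2 + t n)|.
(* Stated as an implication, with a dummy corner when [bad] fails, so that [choice] yields a total
   function. *)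
have step (np : nat * (R * R)) : exists p' : R * R, bad np.1 np.2 ->
    [/\ bad np.1.+1 p', np.2.1 <= p'.1, p'.1 + s np.1.+1 <= np.2.1 + s np.1,
        np.2.2 <= p'.2 & p'.2 + t np.1.+1 <= np.2.2 + t np.1].
  case: np => n [x y] /=.
  have [hb|] := pselect (bad n (x, y)); last by exists (0, 0).
  move: hb; rewrite /bad /= (sS n) (tS n) !addrA.
  have s1 := s0 n.+1; have t1 := t0 n.+1; set sn := s n.+1 in s1 *; set tn := t n.+1 in t1 *.
  rewrite (@rect_splitx x (x + sn)) ?lerDl //.
  rewrite (@rect_splity x _ y (y + tn)) ?lerDl //.
  rewrite (@rect_splity (x + sn) _ y (y + tn)) ?lerDl // => hb.
  have e4 : eta / 4 ^+ n = 4 * (eta / 4 ^+ n.+1).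
    by rewrite exprS; field; rewrite expf_neq0.
  have [h|h1] := leP (eta / 4 ^+ n.+1) `|rect_integral x (x + sn) y (y + tn)|.
    by exists (x, y) => _; split => //=; lra.
  have [h|h2] := leP (eta / 4 ^+ n.+1) `|rect_integral x (x + sn) (y + tn) (y + tn + tn)|.
    by exists (x, y + tn) => _; split => //=; lra.
  have [h|h3] := leP (eta / 4 ^+ n.+1) `|rect_integral (x + sn) (x + sn + sn) y (y + tn)|.
    by exists (x + sn, y) => _; split => //=; lra.
  have [h|h4] := leP (eta / 4 ^+ n.+1) `|rect_integral (x + sn) (x + sn + sn) (y + tn) (y + tn + tn)|.
    by exists (x + sn, y + tn) => _; split => //=; lra.
  exfalso; move: hb; rewrite e4 => hb.
  have := le_trans hb (ler_normD _ _).
  have := ler_normD (rect_integral x (x + sn) y (y + tn)) (rect_integral x (x + sn) (y + tn) (y + tn + tn)).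
  have := ler_normD (rect_integral (x + sn) (x + sn + sn) y (y + tn)) (rect_integral (x + sn) (x + sn + sn) (y + tn) (y + tn + tn)).
  lra.
have [nx Hnx] := choice step.
pose p := fix p n := if n is m.+1 then nx (m, p m) else (a, c).
have bp n : bad n (p n).
  elim: n => [|n IH]; last by have [] := Hnx (n, p n) IH.
  by rewrite /bad /s /t /= !expr0 !divr1 ![_ + (_ - _)]addrC !subrK.
have px n : (p n).1 <= (p n.+1).1 by have [] := Hnx (n, p n) (bp n).
have px' n : (p n.+1).1 + s n.+1 <= (p n).1 + s n by have [] := Hnx (n, p n) (bp n).
have py n : (p n).2 <= (p n.+1).2 by have [] := Hnx (n, p n) (bp n).
have py' n : (p n.+1).2 + t n.+1 <= (p n).2 + t n by have [] := Hnx (n, p n) (bp n).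
have nested (u r : nat -> R) : (forall n, 0 <= r n) -> (forall n, u n <= u n.+1) ->
    (forall n, u n.+1 + r n.+1 <= u n + r n) -> exists x, forall n, u n <= x <= u n + r n.
  move=> r0 u1 u2.
  have um m n : (m <= n)%N -> u m <= u n.
    by move/subnK <-; elim: (n - m)%N => [|i IH]; [rewrite add0n | apply: le_trans IH (u1 _)].
  have ur m n : (m <= n)%N -> u n + r n <= u m + r m.
    by move/subnK <-; elim: (n - m)%N => [|i IH]; [rewrite add0n | apply: le_trans (u2 _) IH].
  have ub n : ubound (range u) (u n + r n).
    move=> _ [m _ <-]; have [mn|/ltnW nm] := leqP m n.
      by apply: le_trans (um _ _ mn) _; rewrite lerDl.
    by apply: le_trans (ur _ _ nm); rewrite lerDl.
  exists (sup (range u)) => n; apply/andP; split.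
    by apply: ub_le_sup; [exists (u 0%N + r 0%N); exact: ub | exists n].
  by apply: ge_sup; [exists (u 0%N), 0%N | exact: ub].
have [x0 Hx] := nested _ _ s0 px px'.
have [y0 Hy] := nested _ _ t0 py py'.
pose K := (b - a) + (d - c).
have K0 : 0 <= K by rewrite addr_ge0 ?subr_ge0.
(* Chosen so that 2 e K^2 < eta; the added 1 allows K = 0, the case of a rectangle reduced to a
   point. *)
pose e := eta / (4 * (K ^+ 2 + 1)).
have K20 : 0 <= K ^+ 2 by rewrite sqr_ge0.
have e0 : 0 < e by rewrite divr_gt0 // mulr_gt0 // ltr_wpDl.
have [dl dl0 Hdl] := rect_small x0 y0 e0.
have [n Hn] : exists n, K / 2 ^+ n < dl.
  have [N HN] : exists N : nat, K / dl < N%:R.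
    by exists (Num.bound (K / dl)); apply: archi_boundP; rewrite divr_ge0 // ltW.
  exists N; rewrite ltr_pdivrMr ?exprn_gt0 // mulrC -ltr_pdivrMr //.
  by apply: lt_trans HN _; rewrite -natrX ltr_nat ltn_expl.
have ssum : (p n).1 + s n - (p n).1 + ((p n).2 + t n - (p n).2) = K / 2 ^+ n.
  by rewrite [LHS](_ : _ = s n + t n); [rewrite -mulrDl | ring].
have := Hdl _ _ _ _ (Hx n) (Hy n); rewrite ssum => /(_ Hn).
move/(le_trans (bp n)).
have -> : 2 * e * (K / 2 ^+ n) ^+ 2 = 2 * e * K ^+ 2 / 4 ^+ n.
  have -> : 4 ^+ n = (2 ^+ n) ^+ 2 :> R by rewrite -exprM mulnC exprM -[2 ^+ 2]natrX.
  by rewrite expr_div_n mulrA.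
rewrite ler_pM2r ?invr_gt0 ?exprn_gt0 //.
suff : 2 * e * K ^+ 2 < eta by move=> h /le_lt_trans/(_ h); rewrite ltxx.
have -> : 2 * e * K ^+ 2 = eta * (K ^+ 2 / (2 * (K ^+ 2 + 1))).
  by rewrite /e; field; apply/lt0r_neq0; rewrite ltr_wpDl.
rewrite gtr_pMr // ltr_pdivrMr ?mulr_gt0 ?ltr_wpDl //; lra.
Qed.

End Goursat.

(** * Means over circles *)

Section CircleMean.
Variable R : realType.
Implicit Types (z w l : R[i]).
Local Notation nc := Normc.normc.

(** The exponential maps vertical segments of length 2 pi onto circles about 0 and takes equal
    values at heights -pi and pi. Thus the horizontal sides cancel in Goursat's theorem and the mean
    is the same for all radii exp(s), s <= 0. As s decreases the circle shrinks to 0, and continuity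
    of [g] there gives the value. *)
Lemma circle_mean0 (g : R[i] -> R[i]) : (forall z, exists l, cdiff g z l) ->
  segint (- pi) pi (fun y => complex.Re (g (cexp (0 +i* y)))) = complex.Re (g 0) * (pi *+ 2).
Proof.
move=> dg; pose F z := g (cexp z).
have dF z : exists l, cdiff F z l.
  have [l D] := dg (cexp z); exists (l * cexp z).
  exact: (cdiff_comp D (cdiff_cexp z)).
have ppi : - pi <= pi :> R by rewrite ge0_cp ?pi_ge0.
pose M s := segint (- pi) pi (fun y => complex.Re (F (s +i* y))).
have Mcst s : s <= 0 -> M 0 = M s.
  move=> s0; have := goursat dF s0 ppi; rewrite /rect_integral.
  have -> : (fun x => complex.Im (F (x +i* - pi)) - complex.Im (F (x +i* pi))) = (fun=> 0).
    by apply/funext => x; rewrite /F /cexp /= cosN sinN sinpi oppr0 subrr.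
  rewrite segint_cst // mul0r add0r segintB; [|exact: U_cont|exact: U_cont].
  by move/eqP; rewrite subr_eq0 => /eqP.
have p2 : pi - - pi = pi *+ 2 :> R by rewrite opprK mulr2n.
apply/eqP; rewrite -subr_eq0 -normr_le0; apply/ler_addgt0Pr => e e0; rewrite add0r.
have p0 : 0 < pi *+ 2 :> R by rewrite mulrn_wgt0 // pi_gt0.
have [l D] := dg 0; have [d d0 Hd] := cdiff_cont D (divr_gt0 e0 p0).
(* The radius exp(s) is below the continuity radius d, and s <= 0 keeps [Mcst] applicable. *)
pose s := Num.min 0 (ln (d / 2)).
have s0 : s <= 0 by rewrite ge_min lexx.
have sd : expR s < d.
  apply: (@le_lt_trans _ _ (d / 2)); last by rewrite ltr_pdivrMr // ltr_pMr // ltr1n.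
  by rewrite -[leRHS]lnK ?posrE ?divr_gt0 // ler_expR /s ge_min lexx orbT.
have -> : segint (- pi) pi (fun y => complex.Re (g (cexp (0 +i* y)))) = M s by rewrite -Mcst.
rewrite -p2; apply: le_trans (@segint_bound _ _ _ _ _ (e / (pi *+ 2)) _ _ _) _ => //.
- exact: U_cont.
- move=> y _; apply: le_trans (Re_lip _ _) _; apply: ltW.
  by have := Hd (cexp (s +i* y)); rewrite add0r; apply; rewrite nc_cexp.
- by rewrite p2 divfK // gt_eqF.
Qed.

Definition cis (y : R) : R[i] := cos y +i* sin y.

Lemma circle_mean (g : R[i] -> R[i]) z : (forall z, exists l, cdiff g z l) ->
  segint (- pi) pi (fun y => complex.Re (g (cis y * z))) = complex.Re (g 0) * (pi *+ 2).
Proof.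
move=> dg; have := @circle_mean0 (fun w => g (z * w + 0)); rewrite mulr0 addr0 => <-.
  congr (segint _ _); apply/funext => y; congr (complex.Re (g _)).
  by rewrite /cexp /= expR0 mul1r addr0 mulrC.
move=> w; have [l D] := dg (z * w + 0); exists (l * z).
exact: (@cdiff_comp _ g (fun w => z * w + 0) w l z D (cdiff_affine z 0 w)).
Qed.

Lemma circle_mean_cont (g : R[i] -> R[i]) z : (forall z, exists l, cdiff g z l) ->
  continuous (fun y => complex.Re (g (cis y * z))).
Proof.
move=> dg; have dF w : exists l, cdiff (fun w => g (z * cexp w + 0)) w l.
  have [l D] := dg (z * cexp w + 0).
  exists (l * z * cexp w); apply: (@cdiff_comp _ (fun v => g (z * v + 0)) _ w (l * z)) (cdiff_cexp w).
  exact: (@cdiff_comp _ g (fun w => z * w + 0) _ l z D (cdiff_affine z 0 _)).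
have := @U_cont R _ dF 0.
have -> // : (fun y => complex.Re (g (z * cexp (0 +i* y) + 0))) = (fun y => complex.Re (g (cis y * z))).
apply/funext => y; congr (complex.Re (g _)).
by rewrite /cexp /= expR0 mul1r addr0 mulrC.
Qed.

End CircleMean.

(** * Area-preserving maps and the Gaussian mean *)

Section Plane.
Variable R : realType.
Local Notation leb := (@lebesgue_measure R).
Local Notation P2 := (R * R)%type.
Local Notation area := (leb \x leb)%E.

(** The sigma-algebra is the one generated by rectangles, so continuity is used through a grid: [u]
    is the pointwise limit of functions constant on countably many half-open squares of side
    1/(n+1). *)
Lemma measurable_plane (u : R * R -> R) :
  (forall (p : P2) (e : R), 0 < e -> exists2 d : R, 0 < d & forall q : P2,
     `|q.1 - p.1| < d -> `|q.2 - p.2| < d -> `|u q - u p| < e) ->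
  @measurable_fun _ _ (measurableTypeR R * measurableTypeR R)%type _ setT u.
Proof.
move=> cu; pose fl n (x : R) : int := Num.floor (n.+1%:R * x).
pose gr n (i : int) : R := i%:~R / n.+1%:R.
have flP n i (x : R) : (fl n x == i) = (gr n i <= x < gr n (i + 1)).
  rewrite /gr ler_pdivrMr // ltr_pdivlMr // ![x * _]mulrC.
  by apply/eqP/idP => [<-|]; [exact: floor_itv | exact: floor_def].
have grx n (x : R) : `|gr n (fl n x) - x| <= n.+1%:R^-1.
  have := eqxx (fl n x); rewrite flP => /andP[h1 h2].
  have : gr n (fl n x + 1) = gr n (fl n x) + n.+1%:R^-1.
    by rewrite /gr rmorphD mulrDl mul1r.
  by move: h1 h2; move: (gr n _) (gr n _) (n.+1%:R^-1) => a b c h1 h2 e; rewrite ler_norml; lra.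
apply: (@measurable_realfun.measurable_fun_cvg _ _ _ setT (fun n p => u (gr n (fl n p.1), gr n (fl n p.2)))).
  move=> n _ Y mY; rewrite setTI.
  pose A (ij : int * int) : set P2 := if pselect (Y (u (gr n ij.1, gr n ij.2))) then
     [set x | fl n x = ij.1] `*` [set x | fl n x = ij.2] else set0.
  have -> : (fun p : P2 => u (gr n (fl n p.1), gr n (fl n p.2))) @^-1` Y = \bigcup_ij A ij.
    apply/seteqP; split => [[x y] /= Yp|[x y] [[i j] _]].
      by exists (fl n x, fl n y) => //; rewrite /A; case: pselect.
    by rewrite /A; case: pselect => //= Yp [/= -> ->].
  apply: countable_bigcupT_measurable; first exact: countableP.
  move=> [i j]; rewrite /A; case: pselect => Yp /=; last exact: measurable0.
  have mfl k : measurable ([set x : R | fl n x = k]).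
    have -> : [set x | fl n x = k] = [set` `[gr n k, gr n (k + 1)[].
      apply/seteqP; split => x /=; rewrite in_itv /= -flP; [by move=> ->|by move/eqP].
    exact: measurable_itv.
  by apply: measurableX; exact: mfl.
move=> [x y] _; apply/cvgrPdist_lt => e e0.
have [d d0 Hd] := cu (x, y) e e0; have [N _ HN] := near_infty_natSinv_lt (PosNum d0).
by exists N => // n /HN nd; rewrite /= distrC; apply: Hd; apply: le_lt_trans (grx _ _) nd.
Qed.

(** The image of Lebesgue measure under a translation has the same value on half-open intervals,
    hence is Lebesgue measure. *)
Lemma integral_translate (f : R -> \bar R) (t : R) :
  measurable_fun setT f -> (forall x, 0 <= f x)%E ->
  (\int[leb]_x f (x + t)%R = \int[leb]_x f x)%E.
Proof.
move=> mf f0.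
have mt : @measurable_fun _ _ (measurableTypeR R) (measurableTypeR R) setT (fun x => x + t).
  by have : measurable_fun setT (fun x : R => x + t) by apply: measurable_funD.
have mf' : @measurable_fun _ _ (measurableTypeR R) _ setT f by [].
have := ge0_integral_pushforward mt leb measurableT mf'.
rewrite preimage_setT => <-; last by move=> y _; exact: f0.
apply: eq_measure_integral => A mA _; apply/esym/lebesgue_measure_unique => //.
move=> _ [[a b]] _ <-.
transitivity (leb `](a - t), (b - t)]%classic); last first.
  rewrite /pushforward; congr (leb _).
  by apply/seteqP; split => x /=; rewrite !in_itv /= ltrBlDr lerBrDr.
rewrite !lebesgue_measure_itv /= !lte_fin ltrD2r; case: ifP => // _.
by rewrite -!EFinB; congr (_%:E); ring.
Qed.

Local Notation mP := (measurableTypeR R * measurableTypeR R)%type.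
Local Notation meas f := (@measurable_fun _ _ mP _ setT f).

(** Phrased through integrals of nonnegative functions instead of measures of preimages: Tonelli's
    theorem proves it for shears, and it is stable under composition at once. *)
Definition area_preserving (T : mP -> mP) := @measurable_fun _ _ mP mP setT T /\
  forall f : mP -> \bar R, meas f -> (forall p, 0 <= f p)%E ->
  (\int[area]_p f (T p) = \int[area]_p f p)%E.

Lemma area_preserving_comp S T : area_preserving S -> area_preserving T ->
  area_preserving (S \o T).
Proof.
move=> [mS aS] [mT aT]; split; first exact: measurableT_comp.
move=> f mf f0; rewrite -(aS f) // -(aT (f \o S)) //.
  exact: (measurableT_comp mf mS).
by move=> p; exact: f0 (S p).
Qed.

(** On each horizontal line the shear is a translation, so integrating in x first reduces it to
    [integral_translate]. *)
Lemma shearx_area (tau : R -> R) : measurable_fun setT tau ->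
  area_preserving (fun p => (p.1 + tau p.2, p.2)).
Proof.
move=> mt.
have mT : @measurable_fun _ _ mP mP setT (fun p => (p.1 + tau p.2, p.2)).
  apply: measurable_fun_pair => //; apply: measurable_funD => //.
  exact: measurableT_comp.
split => // f mf f0.
rewrite (fubini_tonelli2 (fun p : mP => f (p.1 + tau p.2, p.2))) //; last first.
  exact: measurableT_comp.
rewrite fubini_tonelli2 //; apply: eq_integral => y _; rewrite /fubini_G /=.
apply: (@integral_translate (fun x => f (x, y))) => //.
exact: measurableT_comp.
Qed.

Lemma sheary_area (tau : R -> R) : measurable_fun setT tau ->
  area_preserving (fun p => (p.1, p.2 + tau p.1)).
Proof.
move=> mt.
have mT : @measurable_fun _ _ mP mP setT (fun p => (p.1, p.2 + tau p.1)).
  apply: measurable_fun_pair => //; apply: measurable_funD => //.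
  exact: measurableT_comp.
split => // f mf f0.
rewrite (fubini_tonelli1 (fun p : mP => f (p.1, p.2 + tau p.1))) //; last first.
  exact: measurableT_comp.
rewrite fubini_tonelli1 //; apply: eq_integral => x _; rewrite /fubini_F /=.
apply: (@integral_translate (fun y => f (x, y))) => //.
exact: measurableT_comp.
Qed.

Lemma translate_area (a b : R) : area_preserving (fun p => (p.1 + a, p.2 + b)).
Proof.
have := area_preserving_comp (@shearx_area (fun=> a) _) (@sheary_area (fun=> b) _).
apply; exact: measurable_cst.
Qed.

(* A rotation by an angle different from pi is a product of three shears. *)
Lemma rotation_area (c s : R) : c ^+ 2 + s ^+ 2 = 1 ->
  area_preserving (fun p => (c * p.1 - s * p.2, s * p.1 + c * p.2)).
Proof.
have main (a b : R) : a ^+ 2 + b ^+ 2 = 1 -> 1 + a != 0 ->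
    area_preserving (fun p => (a * p.1 - b * p.2, b * p.1 + a * p.2)).
  move=> ab a1.
  (* For a = cos u and b = sin u this t is tan(u/2); the shears have coefficients -t, b and -t. *)
  have [t bt tt] : exists2 t, b * t = 1 - a & t * (1 + a) = b.
    exists (b / (1 + a)); last by rewrite divfK.
    have -> : b * (b / (1 + a)) = b ^+ 2 / (1 + a) by ring.
    have -> : b ^+ 2 = (1 - a) * (1 + a).
      by have -> : b ^+ 2 = 1 - a ^+ 2; [lra | ring].
    by rewrite mulfK.
  have ml (r : R) : measurable_fun setT (fun x : R => r * x).
    exact: measurable_funM.
  have := area_preserving_comp (shearx_area (ml (- t)))
    (area_preserving_comp (sheary_area (ml b)) (shearx_area (ml (- t)))).
  congr area_preserving; apply/funext => -[x y] /=.
  congr pair.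
    have -> : x + - t * y + - t * (y + b * (x + - t * y)) = x * (1 - b * t) - y * (t + t - t * (b * t)) by ring.
    by rewrite bt -tt; ring.
  have -> : y + b * (x + - t * y) = b * x + y * (1 - b * t) by ring.
  by rewrite bt; ring.
move=> cs; have [c1|] := eqVneq (1 + c) 0; last exact: main.
have c1' : c = -1 by apply/eqP; rewrite -addr_eq0 addrC c1.
have s0 : s = 0.
  by apply/eqP; rewrite -sqrf_eq0; move: cs; rewrite c1' => cs; apply/eqP; lra.
(* The remaining half turn is the square of a quarter turn, to which [main] applies. *)
have m01 : area_preserving (fun p => (0 * p.1 - 1 * p.2, 1 * p.1 + 0 * p.2)).
  by apply: main; rewrite ?addr0 ?oner_eq0 // expr0n add0r expr1n.
have := area_preserving_comp m01 m01; congr area_preserving; apply/funext => -[x y] /=.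
by rewrite c1' s0; congr pair; ring.
Qed.

Lemma area_preserving_integral T (f : mP -> \bar R) : area_preserving T ->
  meas f -> (\int[area]_p f (T p) = \int[area]_p f p)%E.
Proof.
move=> [mT aT] mf; rewrite integralE [RHS]integralE -[fun p => f (T p)]/(f \o T).
rewrite (funepos_comp f T) (funeneg_comp f T); congr (_ - _)%E.
  by apply: (aT (f^\+)%E); [exact: measurable_funepos | move=> p; exact: funepos_ge0].
by apply: (aT (f^\-)%E); [exact: measurable_funeneg | move=> p; exact: funeneg_ge0].
Qed.

Lemma area_preserving_integrable T (f : mP -> \bar R) : area_preserving T ->
  area.-integrable setT f -> area.-integrable setT (f \o T).
Proof.
move=> [mT aT] /integrableP[mf fi]; apply/integrableP; split; first exact: measurableT_comp.
by rewrite [X in (X < _)%E](aT (fun p => `|f p|%E)) //; exact: measurableT_comp.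
Qed.

End Plane.

Section PlaneMeasure.
Variable R : realType.
Local Notation mP := (measurableTypeR R * measurableTypeR R)%type.

(** The area under its own name, so that it carries the sigma-finite structure that Fubini's theorem
    asks of it as a factor in the space of pairs (angle, point). *)
Definition plane_measure : set mP -> \bar R :=
  (@lebesgue_measure R \x @lebesgue_measure R)%E.

HB.instance Definition _ := Measure.copy plane_measure
  (@lebesgue_measure R \x @lebesgue_measure R)%E.

Lemma plane_measure_sigma_finite : sigma_finite setT plane_measure.
Proof.
have H := @lebesgue_integral_fubini.measure_function_Measure_isSigmaFinite__to__measure_function_isSigmaFinite
  _ _ _ _ R (@lebesgue_measure R) (@lebesgue_measure R).
by case: H.
Qed.

HB.instance Definition _ :=
  Measure_isSigmaFinite.Build _ _ _ plane_measure plane_measure_sigma_finite.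

End PlaneMeasure.

(** * The Gaussian mean value property *)

Section GaussMean.
Variable R : realType.
Local Notation nc := Normc.normc.
Local Notation leb := (@lebesgue_measure R).
Local Notation area := (leb \x leb)%E.
Local Notation mR := (measurableTypeR R).
Local Notation mP := (mR * mR)%type.
Local Notation meas f := (@measurable_fun _ _ mP _ setT f).

Definition cpt (p : R * R) : R[i] := p.1 +i* p.2.
Definition gwt (p : R * R) : R := expR (- (nc (cpt p) ^+ 2)).

Lemma gwtE p : gwt p = gauss_fun p.1 * gauss_fun p.2.
Proof. by rewrite /gwt /gauss_fun -expRD -opprD ncE. Qed.

Lemma gwt_gt0 p : 0 < gwt p. Proof. exact: expR_gt0. Qed.

Lemma measurable_gwt : meas gwt.
Proof.
have -> : gwt = fun p => gauss_fun p.1 * gauss_fun p.2 by apply/funext => p; exact: gwtE.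
by apply: measurable_funM; apply: measurableT_comp => //; exact: measurable_gauss_fun.
Qed.

Lemma integral_gwt : (\int[area]_p (gwt p)%:E = pi%:E)%E.
Proof.
have mg : measurable_fun setT (EFin \o gauss_fun : mR -> \bar R).
  by apply/measurable_EFinP; exact: measurable_gauss_fun.
have sp0 : 0 <= Num.sqrt pi :> R := sqrtr_ge0 _.
rewrite fubini_tonelli1 //; last 2 first.
- by apply/measurable_EFinP; exact: measurable_gwt.
- by move=> p; rewrite lee_fin ltW // gwt_gt0.
rewrite /fubini_F.
under eq_integral => x _.
  under eq_integral => y _ do rewrite gwtE /= EFinM.
  rewrite ge0_integralZl //; last 2 first.
  - by move=> y _; rewrite lee_fin gauss_fun_ge0.
  - by rewrite lee_fin gauss_fun_ge0.
  rewrite integralT_gauss.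
  over.
rewrite ge0_integralZr //; last by move=> y _; rewrite lee_fin gauss_fun_ge0.
by rewrite integralT_gauss -EFinM -expr2 sqr_sqrtr // pi_ge0.
Qed.

Lemma measurable_holo (g : R[i] -> R[i]) (q : R[i] -> R) : (forall z, exists l, cdiff g z l) ->
  (forall z w, `|q z - q w| <= nc (z - w)) -> meas (fun p => q (g (cpt p))).
Proof.
move=> dg Lq; apply: measurable_plane => p e e0.
have [l D] := dg (cpt p); have [d d0 Hd] := cdiff_cont D e0.
exists (d / 2) => [|r h1 h2]; first by rewrite divr_gt0.
apply: le_lt_trans (Lq _ _) _.
have -> : cpt r = cpt p + (cpt r - cpt p) by rewrite addrC subrK.
apply: Hd; apply: le_lt_trans (nc_le_ReIm _) _ => /=.
by rewrite [d]splitr ltrD.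
Qed.

(** The integral of G(rot y p) over all angles y and points p is computed in both orders. For fixed
    y it is the integral of G, since rotations preserve area; for fixed p it is 2 pi Re g(0) times
    the weight, by the mean over the circle through p. The assumed integrability of G justifies
    Fubini. *)
Lemma gauss_mean (g : R[i] -> R[i]) : (forall z, exists l, cdiff g z l) ->
  area.-integrable setT (fun p => (complex.Re (g (cpt p)) * gwt p)%:E) ->
  (\int[area]_p (complex.Re (g (cpt p)) * gwt p)%:E = (pi * complex.Re (g 0))%:E)%E.
Proof.
move=> dg; pose G p := (complex.Re (g (cpt p)) * gwt p)%:E; rewrite -/G => iG.
have mg := measurable_holo dg (@Re_lip R).
have mG : meas G by case/integrableP : iG.
pose rot (y : R) (p : mP) : mP := (cos y * p.1 - sin y * p.2, sin y * p.1 + cos y * p.2).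
have rotP y : area_preserving (rot y) by apply: rotation_area; rewrite cos2Dsin2.
have rotC y p : cpt (rot y p) = cis y * cpt p.
  by rewrite /cpt /rot /cis /=; simpc; congr Complex; ring.
have rotw y p : gwt (rot y p) = gwt p.
  rewrite /gwt rotC ncM exprMn.
  have -> : nc (cis y) ^+ 2 = 1 by rewrite ncE /= cos2Dsin2.
  by rewrite mul1r.
pose D : set R := [set` `[(- pi)%R, (pi)%R]].
have mD : measurable (D : set mR) by exact: measurable_itv.
have lD : leb D = (pi *+ 2)%:E.
  rewrite lebesgue_measure_itv /= lte_fin gt0_cp ?pi_gt0 //.
  by rewrite -EFinB opprK mulr2n.
have iI : (\int[leb]_y (\1_D y)%:E = (pi *+ 2)%:E)%E.
  by rewrite integral_indic // setIT; exact: lD.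
(* The indicator restricts the angle to [-pi, pi] while the integrals stay over the whole space. *)
pose h (yp : mR * mP) : \bar R := ((\1_D yp.1)%:E * G (rot yp.1 yp.2))%E.
have mrot : @measurable_fun _ _ (mR * mP)%type mP setT (fun yp => rot yp.1 yp.2).
  have mc : @measurable_fun _ _ (mR * mP)%type _ setT (fun yp => cos yp.1 : R).
    apply: (@measurableT_comp _ _ _ _ _ _ (@cos R) _ fst) => //.
    by apply: continuous_measurable_fun; exact: continuous_cos.
  have ms : @measurable_fun _ _ (mR * mP)%type _ setT (fun yp => sin yp.1 : R).
    apply: (@measurableT_comp _ _ _ _ _ _ (@sin R) _ fst) => //.
    by apply: continuous_measurable_fun; exact: continuous_sin.
  have m1 : @measurable_fun _ _ (mR * mP)%type _ setT (fun yp => yp.2.1 : R).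
    by apply: (@measurableT_comp _ _ _ _ _ _ fst _ snd).
  have m2 : @measurable_fun _ _ (mR * mP)%type _ setT (fun yp => yp.2.2 : R).
    by apply: (@measurableT_comp _ _ _ _ _ _ snd _ snd).
  apply: measurable_fun_pair.
    by apply: measurable_funB; apply: measurable_funM.
  by apply: measurable_funD; apply: measurable_funM.
have mI : @measurable_fun _ _ (mR * mP)%type _ setT (fun yp => (\1_D yp.1)%:E : \bar R).
  apply/measurable_EFinP; apply: (@measurableT_comp _ _ _ _ _ _ (\1_D : mR -> R) _ fst) => //.
have mI1 : @measurable_fun _ _ mR _ setT (fun y => (\1_D y)%:E : \bar R) by apply/measurable_EFinP.
have mh : measurable_fun setT h.
  apply: emeasurable_funM => //; exact: (measurableT_comp mG mrot).
have inner_p y : (\int[area]_p h (y, p) = (\1_D y)%:E * \int[area]_p G p)%E.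
  rewrite /h /= (integralZl measurableT (area_preserving_integrable (rotP y) iG)).
  by have -> := area_preserving_integral (rotP y) mG.
have inner_abs y : (\int[area]_p `|h (y, p)| = (\1_D y)%:E * \int[area]_p `|G p|)%E.
  have E p : (`|h (y, p)| = (\1_D y)%:E * `|G (rot y p)|)%E.
    by rewrite /h abseM; congr (_ * _)%E; rewrite gee0_abs // lee_fin.
  under eq_integral => p _ do rewrite E.
  have mGr : meas (fun p => `|G (rot y p)|%E).
    by apply: measurableT_comp => //; exact: (measurableT_comp mG (rotP y).1).
  have I0 : (0 <= (\1_D y : R)%:E)%E by rewrite lee_fin.
  rewrite (ge0_integralZl _ measurableT mGr (fun _ _ => abse_ge0 _) I0).
  have mGa : meas (fun p => `|G p|%E) by exact: measurableT_comp.
  by have -> := (rotP y).2 (fun p => `|G p|%E) mGa (fun p => abse_ge0 _).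
have ih : (leb \x @plane_measure R)%E.-integrable setT h.
  apply/(integrable12ltyP leb (@plane_measure R) mh).
  have -> : (\int[leb]_y \int[@plane_measure R]_p `|h (y, p)| =
      \int[leb]_y ((\1_D y)%:E * \int[area]_p `|G p|))%E.
    by apply: eq_integral => y _; exact: inner_abs.
  have A0 : (0 <= \int[area]_p `|G p|)%E by apply: integral_ge0.
  have I0 (y : mR) : setT y -> (0 <= (\1_D y : R)%:E)%E by move=> _; rewrite lee_fin.
  rewrite (ge0_integralZr _ measurableT mI1 I0 A0).
  case/integrableP : iG => _ Gfin; rewrite iI; apply: lte_mul_pinfty => //.
  by rewrite lee_fin mulrn_wge0 // pi_ge0.
have F : (\int[leb]_y \int[area]_p h (y, p) = \int[area]_p \int[leb]_y h (y, p))%E := Fubini ih.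
have fB : (\int[area]_p G p)%E \is a fin_num by exact: integrable_fin_num.
have iD : leb.-integrable setT (fun y => (\1_D y)%:E : \bar R).
  apply/integrableP; split => //.
  under eq_integral => y _ do rewrite gee0_abs ?lee_fin //.
  by rewrite iI ltry.
have L : (\int[leb]_y \int[area]_p h (y, p) = \int[area]_p G p * (pi *+ 2)%:E)%E.
  rewrite -iI -(fineK fB) -(integralZl measurableT iD).
  by apply: eq_integral => y _; rewrite inner_p -{1}(fineK fB) muleC.
have inner_y p : (\int[leb]_y h (y, p) = (complex.Re (g 0) * (pi *+ 2))%:E * (gwt p)%:E)%E.
  have cg := circle_mean_cont (z := cpt p) dg.
  have iS := segint_integrable (- pi) pi cg.
  rewrite -(circle_mean (cpt p) dg) /segint fineK; last exact: integrable_fin_num iS.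
  rewrite muleC -(integralZl _ iS) // [RHS]integral_mkcond.
  apply: eq_integral => y _; rewrite /h /G /= rotC rotw patchE indicE.
  by case: (y \in _); rewrite ?mul1e ?mul0e // EFinM muleC.
have RR : (\int[area]_p \int[leb]_y h (y, p) = (complex.Re (g 0) * (pi *+ 2))%:E * pi%:E)%E.
  under eq_integral => p _ do rewrite inner_y.
  rewrite -integral_gwt -integralZl //.
  apply/integrableP; split; first by apply/measurable_EFinP; exact: measurable_gwt.
  under eq_integral => p _ do rewrite gee0_abs ?lee_fin ?(ltW (gwt_gt0 _)) //.
  by rewrite integral_gwt ltry.
move: F; rewrite L RR -(fineK fB) -!EFinM => -[] e; congr (_%:E).
have p0 : pi *+ 2 != 0 :> R by rewrite mulrn_eq0 /= gt_eqF // pi_gt0.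
by apply: (mulIf p0); rewrite e; ring.
Qed.
End GaussMean.

(** * The Fock space *)

Section L2.
Variable R : realType.
Local Notation nc := Normc.normc.
Local Notation leb := (@lebesgue_measure R).
Local Notation area := (leb \x leb)%E.
Local Notation mR := (measurableTypeR R).
Local Notation mP := (mR * mR)%type.
Local Notation meas f := (@measurable_fun _ _ mP _ setT f).
Implicit Types (f g h : R[i] -> R[i]) (F G : R * R -> R[i]).

Definition cintegrable F := area.-integrable setT (fun p => (complex.Re (F p))%:E) /\
  area.-integrable setT (fun p => (complex.Im (F p))%:E).

Definition cint F : R[i] := Rintegral area setT (fun p => complex.Re (F p)) +i*
   Rintegral area setT (fun p => complex.Im (F p)).

Lemma cint_lin a F G : cintegrable F -> cintegrable G ->
  cint (fun p => a * F p + G p) = a * cint F + cint G.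
Proof.
move=> [rF iF] [rG iG].
have Z (c : R) (u : mP -> R) : area.-integrable setT (EFin \o u) ->
    area.-integrable setT (EFin \o (fun p => c * u p)).
  by move=> iu; exact: (integrableZl measurableT c iu).
have DD (u v : mP -> R) : area.-integrable setT (EFin \o u) -> area.-integrable setT (EFin \o v) ->
    area.-integrable setT (EFin \o (fun p => u p + v p)).
  by move=> iu iv; exact: (integrableD measurableT iu iv).
rewrite /cint.
have -> : (fun p => complex.Re (a * F p + G p)) =
   (fun p => complex.Re a * complex.Re (F p) + (- complex.Im a * complex.Im (F p) + complex.Re (G p))).
  by apply/funext => p; case: a (F p) (G p) => ? ? [? ?] [? ?] /=; ring.
have -> : (fun p => complex.Im (a * F p + G p)) =
   (fun p => complex.Re a * complex.Im (F p) + (complex.Im a * complex.Re (F p) + complex.Im (G p))).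
  by apply/funext => p; case: a (F p) (G p) => ? ? [? ?] [? ?] /=; ring.
rewrite (RintegralD measurableT (Z _ _ rF) (DD _ _ (Z _ _ iF) rG)).
rewrite (RintegralD measurableT (Z _ _ iF) rG).
rewrite (RintegralD measurableT (Z _ _ iF) (DD _ _ (Z _ _ rF) iG)).
rewrite (RintegralD measurableT (Z _ _ rF) iG).
rewrite (RintegralZl _ measurableT rF) (RintegralZl _ measurableT iF).
rewrite (RintegralZl _ measurableT rF) (RintegralZl _ measurableT iF).
move: (Rintegral _ _ _) (Rintegral _ _ _) (Rintegral _ _ _) (Rintegral _ _ _) => x y z t.
by case: a => b c; apply/eqP; rewrite eq_complex /=; apply/andP; split; apply/eqP; ring.
Qed.

Lemma cint_conj F : cintegrable F -> cint (fun p => (F p)^*) = (cint F)^*.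
Proof.
move=> [rF iF]; rewrite /cint.
have -> : (fun p => complex.Re (F p)^*) = (fun p => complex.Re (F p)).
  by apply/funext => p; case: (F p).
have -> : (fun p => complex.Im (F p)^*) = (fun p => -1 * complex.Im (F p)).
  by apply/funext => p; rewrite mulN1r; case: (F p).
by rewrite (RintegralZl _ measurableT iF) mulN1r.
Qed.

Definition L2int f g (p : R * R) : R[i] := f (cpt p) * (g (cpt p))^* * (gwt p)%:C.
Definition sqd f (p : R * R) : R := nc (f (cpt p)) ^+ 2 * gwt p.
Definition L2 f := [/\ meas (fun p => complex.Re (f (cpt p))),
  meas (fun p => complex.Im (f (cpt p))) & area.-integrable setT (EFin \o sqd f)].

Lemma fock_innerE f g : fock_inner f g = (pi^-1)%:C * cint (L2int f g).
Proof. by []. Qed.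

Lemma fock_sqnormE f : fock_sqnorm f = ((pi^-1)%:E * \int[area]_p (sqd f p)%:E)%E.
Proof. by []. Qed.

Lemma sqd_ge0 f p : 0 <= sqd f p.
Proof. by rewrite mulr_ge0 ?sqr_ge0 // ltW // gwt_gt0. Qed.

Lemma measurable_sqd f : meas (fun p => complex.Re (f (cpt p))) ->
  meas (fun p => complex.Im (f (cpt p))) -> meas (sqd f).
Proof.
move=> mr mi; have -> : sqd f = (fun p => (complex.Re (f (cpt p)) ^+ 2 + complex.Im (f (cpt p)) ^+ 2) * gwt p).
  by apply/funext => p; rewrite /sqd ncE.
apply: measurable_funM; last exact: measurable_gwt.
by apply: measurable_funD; exact: measurable_funX.
Qed.

Lemma integrable_nonneg (u : mP -> R) : meas u -> (forall p, 0 <= u p) ->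
  (\int[area]_p (u p)%:E < +oo)%E -> area.-integrable setT (EFin \o u).
Proof.
move=> mu u0 fin; apply/integrableP; split; first exact/measurable_EFinP.
rewrite (_ : (fun p => `|(EFin \o u) p|%E) = (fun p => (u p)%:E)) //.
by apply/funext => p /=; rewrite ger0_norm.
Qed.

Lemma integrable_dominated (u v : mP -> R) : meas u -> (forall p, `|u p| <= v p) ->
  area.-integrable setT (EFin \o v) -> area.-integrable setT (EFin \o u).
Proof.
move=> mu uv iv; apply: (le_integrable measurableT _ _ iv); first exact/measurable_EFinP.
move=> p _ /=; rewrite lee_fin; apply: le_trans (uv p) _; exact: ler_norm.
Qed.

Lemma L2P f : meas (fun p => complex.Re (f (cpt p))) ->
  meas (fun p => complex.Im (f (cpt p))) -> (fock_sqnorm f < +oo)%E -> L2 f.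
Proof.
move=> mr mi fin; split => //; apply: integrable_nonneg; [exact: measurable_sqd|exact: sqd_ge0|].
have I0 : (0 <= \int[area]_p (sqd f p)%:E)%E.
  by apply: integral_ge0 => p _; rewrite lee_fin sqd_ge0.
move: fin; rewrite fock_sqnormE; move: I0.
move: (\int[area]_p (sqd f p)%:E)%E => [r _ _||] //; first by rewrite ltry.
by move=> _; rewrite mulry gtr0_sg ?mul1e // invr_gt0 pi_gt0.
Qed.

Lemma L2_sqnorm f : L2 f -> (fock_sqnorm f < +oo)%E.
Proof.
case=> _ _ /integrableP[_]; rewrite (_ : (fun p => `|(EFin \o sqd f) p|%E) = (fun p => (sqd f p)%:E)); last first.
  by apply/funext => p /=; rewrite ger0_norm // sqd_ge0.
move=> fin; rewrite fock_sqnormE; apply: lte_mul_pinfty fin => //.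
by rewrite lee_fin invr_ge0 pi_ge0.
Qed.

(** Domination: |f g| <= |f|^2 + |g|^2. *)
Lemma L2_integrable f g : L2 f -> L2 g -> cintegrable (L2int f g).
Proof.
move=> [rf if_ sf] [rg ig sg].
have isum : area.-integrable setT (EFin \o (fun p => sqd f p + sqd g p)).
  exact: (integrableD measurableT sf sg).
have B p : nc (L2int f g p) <= sqd f p + sqd g p.
  rewrite /L2int /sqd !ncM ncJ ncR gtr0_norm ?gwt_gt0 // -mulrDl ler_wpM2r ?(ltW (gwt_gt0 _)) //.
  by move: (nc _) (nc _) => a b; have := sqr_ge0 (a - b); have := sqr_ge0 (a + b); rewrite !sqrrD; lra.
have mw : meas (@gwt R) := @measurable_gwt R.
split; apply: (integrable_dominated _ _ isum).
- have -> : (fun p => complex.Re (L2int f g p)) = (fun p =>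
     (complex.Re (f (cpt p)) * complex.Re (g (cpt p)) + complex.Im (f (cpt p)) * complex.Im (g (cpt p))) * gwt p).
    by apply/funext => p; rewrite /L2int; case: (f _) (g _) => ? ? [? ?] /=; ring.
  by apply: measurable_funM => //; apply: measurable_funD; apply: measurable_funM.
- by move=> p; apply: le_trans (B p); exact: Re_le_nc.
- have -> : (fun p => complex.Im (L2int f g p)) = (fun p =>
     (complex.Im (f (cpt p)) * complex.Re (g (cpt p)) - complex.Re (f (cpt p)) * complex.Im (g (cpt p))) * gwt p).
    by apply/funext => p; rewrite /L2int; case: (f _) (g _) => ? ? [? ?] /=; ring.
  by apply: measurable_funM => //; apply: measurable_funB; apply: measurable_funM.
- by move=> p; apply: le_trans (B p); exact: Im_le_nc.
Qed.

Lemma L2_lin a f g : L2 f -> L2 g -> L2 (fun z => a * f z + g z).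
Proof.
move=> [rf if_ sf] [rg ig sg].
have mr : meas (fun p => complex.Re (a * f (cpt p) + g (cpt p))).
  have -> : (fun p => complex.Re (a * f (cpt p) + g (cpt p))) = (fun p =>
     complex.Re a * complex.Re (f (cpt p)) - complex.Im a * complex.Im (f (cpt p)) + complex.Re (g (cpt p))).
    by apply/funext => p; case: (a) (f _) (g _) => ? ? [? ?] [? ?].
  by apply: measurable_funD => //; apply: measurable_funB; apply: measurable_funM.
have mi : meas (fun p => complex.Im (a * f (cpt p) + g (cpt p))).
  have -> : (fun p => complex.Im (a * f (cpt p) + g (cpt p))) = (fun p =>
     complex.Re a * complex.Im (f (cpt p)) + complex.Im a * complex.Re (f (cpt p)) + complex.Im (g (cpt p))).
    by apply/funext => p; case: (a) (f _) (g _) => ? ? [? ?] [? ?].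
  by apply: measurable_funD => //; apply: measurable_funD; apply: measurable_funM.
split => //.
have i2 : area.-integrable setT (EFin \o (fun p => (2 * nc a ^+ 2) * sqd f p + 2 * sqd g p)).
  exact: (integrableD measurableT (integrableZl measurableT _ sf) (integrableZl measurableT _ sg)).
apply: (integrable_dominated _ _ i2); first exact: measurable_sqd.
move=> p; rewrite ger0_norm ?sqd_ge0 // /sqd !mulrA -mulrDl ler_wpM2r ?(ltW (gwt_gt0 _)) //.
have := ncD (a * f (cpt p)) (g (cpt p)); rewrite ncM.
have := nc_ge0 (a * f (cpt p) + g (cpt p)).
move: (nc _) (nc _) (nc _) (nc _) => x y z t x0 xy.
have x1 := le_trans x0 xy.
have : t ^+ 2 <= (z * y + x) ^+ 2 by rewrite ler_pXn2r ?nnegrE.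
move/le_trans; apply; rewrite [leRHS](_ : _ = (z * y + x) ^+ 2 + (z * y - x) ^+ 2); last by ring.
by rewrite lerDl sqr_ge0.
Qed.

(** The inner product is that of [fock], so norms in the two spaces agree by conversion, and limits
    can be estimated here before they are known to be entire. *)
Definition L2space := FSpace [set f | L2 f] (@fock_inner R).

Lemma L2_prehilbert : is_prehilbert L2space.
Proof.
split => /=.
- split.
  + exact: measurable_cst.
  + exact: measurable_cst.
  + rewrite (_ : EFin \o _ = cst 0%E); first exact: integrable0.
    by apply/funext => p; rewrite /sqd /= expr0n addr0 sqrtr0 expr0n mul0r.
- exact: L2_lin.
- move=> a f g h Lf Lg Lh; rewrite !fock_innerE.
  have -> : L2int (fun z => a * f z + g z) h = (fun p => a * L2int f h p + L2int g h p).
    by apply/funext => p; rewrite /L2int; ring.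
  by rewrite cint_lin; [ring | exact: L2_integrable | exact: L2_integrable].
- move=> f g Lf Lg; rewrite !fock_innerE.
  have -> : L2int g f = (fun p => (L2int f g p)^*).
    apply/funext => p; rewrite /L2int; case: (f _) (g _) => a b [c d].
    by apply/eqP; rewrite eq_complex /=; apply/andP; split; apply/eqP; ring.
  rewrite cint_conj; last exact: L2_integrable.
  by rewrite rmorphM; congr (_ * _); exact/esym/conjc_real.
- move=> f Lf; rewrite fock_innerE; apply: mulr_ge0.
    by rewrite lecE /= eqxx invr_ge0 pi_ge0.
  have -> : L2int f f = (fun p => (sqd f p)%:C).
    apply/funext => p; rewrite /L2int /sqd; case: (f _) => x y.
    by rewrite ncE; simpc; congr Complex => /=; ring.
  rewrite lecE /=; apply/andP; split.
    by rewrite Rintegral_cst // mul0r.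
  by apply: Rintegral_ge0 => p _; exact: sqd_ge0.
Qed.

End L2.

(** * The reproducing formula *)

Section Fock.
Variable R : realType.
Local Notation nc := Normc.normc.
Local Notation leb := (@lebesgue_measure R).
Local Notation area := (leb \x leb)%E.
Local Notation mR := (measurableTypeR R).
Local Notation mP := (mR * mR)%type.
Local Notation meas f := (@measurable_fun _ _ mP _ setT f).
Local Notation fock := (fock R).
Local Notation L2space := (L2space R).
Local Notation k := (@fock_kernel R).
Implicit Types (f g h : R[i] -> R[i]) (z w : R[i]).

Lemma fock_L2 f : carrier fock f -> L2 f.
Proof.
case=> /entireP ef fin.
apply: L2P fin; apply: measurable_holo => //; [exact: Re_lip|exact: Im_lip].
Qed.

Lemma L2_fock f : entire f -> L2 f -> carrier fock f.
Proof. by move=> ef Lf; split => //; exact: L2_sqnorm. Qed.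

Lemma fock_prehilbert : is_prehilbert fock.
Proof.
have pL := L2_prehilbert R.
split.
- apply: L2_fock; last exact: (carrier0 pL).
  by apply/entireP => z; exists 0; exact: cdiff_cst.
- move=> a f g Cf Cg; apply: L2_fock; last by apply: (carrier_lin pL); exact: fock_L2.
  apply/entireP => z; have [/entireP/(_ z)[l Dl] _] := Cf; have [/entireP/(_ z)[m Dm] _] := Cg.
  by exists (a * l + m); exact: cdiff_lin.
- by move=> a f g h Cf Cg Ch; apply: (inner_lin pL); exact: fock_L2.
- by move=> f g Cf Cg; apply: (inner_conj pL); exact: fock_L2.
- by move=> f Cf; apply: (prehilbert_inner_ge0 pL); exact: fock_L2.
Qed.

Lemma sqnorm_hnorm f : L2 f -> fock_sqnorm f = (hnorm L2space f ^+ 2)%:E.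
Proof.
move=> Lf; rewrite (hnorm_sq (L2_prehilbert R) Lf) fock_sqnormE [inner _ _ _]fock_innerE.
have -> : L2int f f = (fun p => (sqd f p)%:C).
  apply/funext => p; rewrite /L2int /sqd; case: (f _) => x y.
  by rewrite ncE; simpc; congr Complex => /=; ring.
have [_ _ sf] := Lf; have fin := integrable_fin_num measurableT sf.
have -> : cint (fun p => (sqd f p)%:C) = (Rintegral area setT (sqd f))%:C.
  by rewrite /cint /= Rintegral_cst // mul0r.
rewrite -rmorphM EFinM /Rintegral.
by rewrite (fineK fin).
Qed.

(** Completing the square: 2 Re(z conj(w)) - |z|^2 = |w|^2 - |z - w|^2. Square integrability of k_w
    thus reduces to a translated Gaussian. *)
Lemma kernel_sqd w p :
  sqd (k^~ w) p = expR (nc w ^+ 2) * gwt (p.1 - complex.Re w, p.2 - complex.Im w).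
Proof.
rewrite /sqd /fock_kernel nc_cexp -expRM_natl /gwt -!expRD; congr expR.
rewrite !ncE /cpt; case: w p => a b [x y] /=; ring.
Qed.

Lemma entire_kernel w : entire (k^~ w).
Proof.
apply/entireP => z; exists (cexp (w^* * z) * w^*).
have -> : k^~ w = (fun z => cexp (w^* * z)) by apply/funext => v; rewrite /fock_kernel mulrC.
exact: cdiff_cexpM.
Qed.

Lemma L2_kernel w : L2 (k^~ w).
Proof.
have /entireP ek := @entire_kernel w.
split; [exact: (measurable_holo ek (@Re_lip R)) | exact: (measurable_holo ek (@Im_lip R)) |].
have iw : area.-integrable setT (EFin \o @gwt R).
  apply: integrable_nonneg; [exact: measurable_gwt | by move=> p; exact: ltW (gwt_gt0 p) |].
  by rewrite integral_gwt ltry.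
have it := area_preserving_integrable (@translate_area R (- complex.Re w) (- complex.Im w)) iw.
have -> : EFin \o sqd (k^~ w) = (fun p => (expR (nc w ^+ 2))%:E * ((EFin \o @gwt R) \o
   (fun p => (p.1 + - complex.Re w, p.2 + - complex.Im w))%R) p)%E.
  by apply/funext => p /=; rewrite kernel_sqd EFinM.
exact: integrableZl.
Qed.

Lemma fock_kernel_carrier w : carrier fock (k^~ w).
Proof. by apply: L2_fock; [exact: entire_kernel | exact: L2_kernel]. Qed.

Lemma gauss_mean_cint g : entire g -> cintegrable (fun p => g (cpt p) * (gwt p)%:C) ->
  cint (fun p => g (cpt p) * (gwt p)%:C) = pi%:C * g 0.
Proof.
move=> /entireP eg [rg ig].
have eq_re : (fun p => complex.Re (g (cpt p) * (gwt p)%:C)) = (fun p => complex.Re (g (cpt p)) * gwt p).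
  by apply/funext => p; case: (g _) => a b /=; ring.
(* [gauss_mean] only sees real parts, and Im g = Re(-i g). *)
pose g' z := - 'i * g z + 0.
have eg' z : exists l, cdiff g' z l.
  have [l D] := eg z; exists (- 'i * l + 0); exact: cdiff_lin D (cdiff_cst 0 z).
have eq_im : (fun p => complex.Im (g (cpt p) * (gwt p)%:C)) = (fun p => complex.Re (g' (cpt p)) * gwt p).
  by apply/funext => p; rewrite /g'; case: (g _) => a b /=; ring.
rewrite /cint /Rintegral; move: rg ig.
rewrite (_ : (fun p => (complex.Re (g (cpt p) * (gwt p)%:C))%:E) = (fun p => (complex.Re (g (cpt p)) * gwt p)%:E)); last first.
  by apply/funext => p; rewrite -[in RHS](congr1 (@^~ p) eq_re).
rewrite (_ : (fun p => (complex.Im (g (cpt p) * (gwt p)%:C))%:E) = (fun p => (complex.Re (g' (cpt p)) * gwt p)%:E)); last first.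
  by apply/funext => p; rewrite -[in RHS](congr1 (@^~ p) eq_im).
move=> rg ig; rewrite (gauss_mean eg rg) (gauss_mean eg' ig) /=.
rewrite /g'; case: (g 0) => a b /=; apply/eqP; rewrite eq_complex /=.
by apply/andP; split; apply/eqP; ring.
Qed.

(** Substituting z + w for z in the integrand of <f, k_w>, the antiholomorphic factors of the
    conjugate kernel and of the weight cancel: there remains f(z + w) exp(-conj(w) z) exp(-|z|^2).
    The Gaussian mean of the entire factor [g] is its value at 0, which is f(w). *)
Lemma fock_reproducing f w : carrier fock f -> fock_inner f (k^~ w) = f w.
Proof.
move=> Cf; have Lf := fock_L2 Cf; have [ef _] := Cf.
pose g z := f (1 * z + w) * cexp (- w^* * z).
have eg : entire g.
  apply/entireP => z; move/entireP : ef => /(_ (1 * z + w))[l D].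
  eexists; apply: cdiff_mul; last exact: cdiff_cexpM.
  exact: (@cdiff_comp _ f (fun z => 1 * z + w) z l 1 D (cdiff_affine 1 w z)).
pose T (p : mP) : mP := (p.1 + complex.Re w, p.2 + complex.Im w).
have aT : area_preserving T := @translate_area R (complex.Re w) (complex.Im w).
have FT : (fun p => g (cpt p) * (gwt p)%:C) = L2int f (k^~ w) \o T.
  apply/funext => p; rewrite /g /L2int /T /= /fock_kernel.
  have -> : cpt (p.1 + complex.Re w, p.2 + complex.Im w) = cpt p + w.
    by case: w {g eg T aT} => a b.
  rewrite mul1r -[LHS]mulrA -[RHS]mulrA; congr (_ * _); rewrite cexpJ.
  have wC (q : R * R) : (gwt q)%:C = cexp (- (cpt q * (cpt q)^*)).
    have -> : cpt q * (cpt q)^* = (nc (cpt q) ^+ 2)%:C.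
      rewrite ncE; case: (cpt q) => x y.
      by apply/eqP; rewrite eq_complex /=; apply/andP; split; apply/eqP; ring.
    rewrite -rmorphN /gwt /cexp /= cos0 sin0.
    by apply/eqP; rewrite eq_complex /=; apply/andP; split; apply/eqP; ring.
  rewrite (wC p).
  rewrite (wC (p.1 + complex.Re w, p.2 + complex.Im w)).
  refine (etrans (esym (cexpD _ _)) (etrans _ (cexpD _ _))).
  apply: (congr1 (@cexp R)).
  have -> : cpt (p.1 + complex.Re w, p.2 + complex.Im w) = cpt p + w.
    by case: w {g eg T aT} => a b.
  by rewrite !rmorphM !rmorphD /= conjCK; ring.
have cF := L2_integrable Lf (L2_kernel w).
have cG : cintegrable (fun p => g (cpt p) * (gwt p)%:C).
  by rewrite FT; case: cF => rF iF; split; [exact: area_preserving_integrable aT rF | exact: area_preserving_integrable aT iF].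
have := gauss_mean_cint eg cG.
have -> : cint (fun p => g (cpt p) * (gwt p)%:C) = cint (L2int f (k^~ w)).
  rewrite FT /cint /Rintegral; case: cF => /integrableP[mr _] /integrableP[mi _].
  by rewrite -(area_preserving_integral aT mr) -(area_preserving_integral aT mi).
rewrite fock_innerE => ->; rewrite /g !mulr0 add0r cexp0 mulr1 mulrA -rmorphM.
by rewrite mulVf ?gt_eqF ?pi_gt0 // mul1r.
Qed.

End Fock.

(** * Completeness of the Fock space and density of the domain of the derivative *)

Section FockComplete.
Variable R : realType.
Local Notation nc := Normc.normc.
Local Notation leb := (@lebesgue_measure R).
Local Notation area := (leb \x leb)%E.
Local Notation mR := (measurableTypeR R).
Local Notation mP := (mR * mR)%type.
Local Notation meas f := (@measurable_fun _ _ mP _ setT f).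
Local Notation fock := (fock R).
Local Notation L2space := (L2space R).
Local Notation k := (@fock_kernel R).
Implicit Types (f g : R[i] -> R[i]) (h z w : R[i]).

Let pL : is_prehilbert L2space := L2_prehilbert R.

Lemma L2_dominated (r : R[i] -> R[i]) (S : mP -> R) (c : R) :
  meas (fun p => complex.Re (r (cpt p))) -> meas (fun p => complex.Im (r (cpt p))) ->
  area.-integrable setT (EFin \o S) -> (forall p, sqd r p <= c * S p) ->
  L2 r /\ hnorm L2space r ^+ 2 <= c * (pi^-1 * Rintegral area setT S).
Proof.
move=> mr mi iS le.
have icS : area.-integrable setT (EFin \o (fun p => c * S p)) by exact: (integrableZl measurableT c iS).
have Lr : L2 r.
  split => //; apply: (integrable_dominated (measurable_sqd mr mi) _ icS) => p.
  by rewrite ger0_norm ?sqd_ge0.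
split => //; have [_ _ sr] := Lr.
have E : hnorm L2space r ^+ 2 = pi^-1 * Rintegral area setT (sqd r).
  apply: EFin_inj; rewrite -sqnorm_hnorm // fock_sqnormE EFinM /Rintegral.
  by rewrite (fineK (integrable_fin_num measurableT sr)).
rewrite E mulrCA ler_wpM2l ?invr_ge0 ?pi_ge0 //.
rewrite -(RintegralZl c measurableT iS).
by apply: (le_Rintegral measurableT sr icS) => p _; exact: le.
Qed.

(** Chosen so that |k(z, corner j)| runs through exp(2(+-Re z +- Im z)); for the right signs the
    exponent is 2(|Re z| + |Im z|) >= 2|z|. *)
Definition corner (j : 'I_4) : R[i] :=
  match val j with 0%N => 2 +i* 2 | 1%N => 2 +i* -2 | 2%N => -2 +i* 2 | _ => -2 +i* -2 end.

Lemma exp_le_corners z : expR (2 * nc z) <= \sum_(j < 4) nc (k z (corner j)).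
Proof.
have -> : \sum_(j < 4) nc (k z (corner j)) = expR (2 * (complex.Re z + complex.Im z))
   + (expR (2 * (complex.Re z - complex.Im z)) + (expR (2 * (- complex.Re z + complex.Im z))
   + expR (2 * (- complex.Re z - complex.Im z)))).
  rewrite !big_ord_recl big_ord0 addr0 /fock_kernel !nc_cexp.
  case: z => x y /=; congr (_ + (_ + (_ + _))); congr expR; ring.
have := nc_le_ReIm z; set x := complex.Re z; set y := complex.Im z => le.
have ea := expR_ge0 (2 * (x + y)); have eb := expR_ge0 (2 * (x - y)).
have ec := expR_ge0 (2 * (- x + y)); have ed := expR_ge0 (2 * (- x - y)).
have P t : 2 * nc z <= t -> expR (2 * nc z) <= expR t by rewrite ler_expR.
have [x0|/ltW x0] := leP 0 x; have [y0|/ltW y0] := leP 0 y; move: le;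
  rewrite ?(ger0_norm x0) ?(ger0_norm y0) ?(ler0_norm x0) ?(ler0_norm y0) => le.
- by apply: le_trans (P (2 * (x + y)) _) _; lra.
- by apply: le_trans (P (2 * (x - y)) _) _; lra.
- by apply: le_trans (P (2 * (- x + y)) _) _; lra.
- by apply: le_trans (P (2 * (- x - y)) _) _; lra.
Qed.

(* An integrable majorant of the squared modulus of exp(2|z|) k_w. *)
Definition kernel_bound w (p : R * R) : R := 4 * \sum_(j < 4) sqd (k^~ (w + corner j)) p.

Lemma integrable_kernel_bound w : area.-integrable setT (EFin \o kernel_bound w).
Proof.
have H : area.-integrable setT (EFin \o (fun p => \sum_(j < 4) sqd (k^~ (w + corner j)) p)).
  have -> : EFin \o (fun p => \sum_(j < 4) sqd (k^~ (w + corner j)) p) =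
      (fun p => \sum_(j < 4) (sqd (k^~ (w + corner j)) p)%:E)%E.
    by apply/funext => p /=; rewrite sumEFin.
  by apply: integrable_sum => // j _; have [_ _] := L2_kernel (w + corner j).
exact: (integrableZl measurableT 4 H).
Qed.

Lemma sqr_sum4 (a : 'I_4 -> R) : (\sum_(j < 4) a j) ^+ 2 <= 4 * \sum_(j < 4) a j ^+ 2.
Proof.
rewrite !big_ord_recl !big_ord0 !addr0.
move: (a _) (a _) (a _) (a _) => x y z t.
have := sqr_ge0 (x - y); have := sqr_ge0 (x - z); have := sqr_ge0 (x - t).
have := sqr_ge0 (y - z); have := sqr_ge0 (y - t); have := sqr_ge0 (z - t).
nra.
Qed.

(** Since |k(z, w + v)| = |k(z, w)| |k(z, v)|, the factor exp(2|z|) is absorbed into kernels at the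
    four shifted points. The 4 in [kernel_bound] comes from Cauchy-Schwarz for a sum of four
    terms. *)
Lemma sqd_kernel_bound (r : R[i] -> R[i]) w (c : R) : 0 <= c ->
  (forall z, nc (r z) <= c * (expR (2 * nc z) * nc (k z w))) ->
  forall p, sqd r p <= c ^+ 2 * kernel_bound w p.
Proof.
move=> c0 le p; rewrite /kernel_bound /sqd -big_distrl /= mulrA mulrA.
rewrite ler_wpM2r ?(ltW (gwt_gt0 _)) //.
have kD j : nc (k (cpt p) (w + corner j)) = nc (k (cpt p) (corner j)) * nc (k (cpt p) w).
  by rewrite /fock_kernel rmorphD mulrDr cexpD ncM mulrC.
apply: (@le_trans _ _ (c ^+ 2 * (\sum_(j < 4) nc (k (cpt p) (w + corner j))) ^+ 2)); last first.
  by rewrite -mulrA ler_wpM2l ?sqr_ge0 // sqr_sum4.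
under eq_bigr => j _ do rewrite kD.
rewrite -big_distrl -exprMn /= ler_pXn2r ?nnegrE ?nc_ge0 //; last first.
  by rewrite mulr_ge0 // mulr_ge0 ?nc_ge0 // sumr_ge0 // => j _; exact: nc_ge0.
apply: le_trans (le _) _; rewrite ler_wpM2l // ler_wpM2r ?nc_ge0 //.
exact: exp_le_corners.
Qed.

Lemma sqr_le_exp (t : R) : 0 <= t -> t ^+ 2 <= 2 * expR t.
Proof.
move=> t0; have := expR_ge1Dxn 1 t0; rewrite (_ : 2`!%:R = 2) // => h.
have : t ^+ 2 / 2 <= expR t by apply: le_trans h; rewrite lerDr.
by rewrite ler_pdivrMr // mulrC.
Qed.

(** The derivative at w is <f, z k_w>. The remainder is the inner product of f with k_w (exp(z
    conj(h)) - 1 - z conj(h)), whose norm is O(|h|^2); the conjugate of h undoes the conjugate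
    linearity in the second argument. *)
Lemma L2_reproducing_entire f : L2 f -> (forall w, f w = fock_inner f (k^~ w)) -> entire f.
Proof.
move=> Lf rep; apply/entireP => w.
pose q z := z * k z w.
have eq_ z : exists l, cdiff q z l.
  have [l D] := (entireP _).1 (@entire_kernel R w) z.
  by eexists; exact: cdiff_mul (@cdiff_id R z) D.
have mqr := measurable_holo eq_ (@Re_lip R); have mqi := measurable_holo eq_ (@Im_lip R).
have Lq : L2 q.
  have [] := L2_dominated mqr mqi (integrable_kernel_bound w) (sqd_kernel_bound ler01 _) => // z.
  rewrite /q ncM mul1r ler_wpM2r ?nc_ge0 //.
  apply: le_trans (_ : expR (nc z) <= _); last by rewrite ler_expR ler_peMl ?nc_ge0 // ler1n.
  by apply: le_trans (expR_ge1Dx _); rewrite lerDr.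
(* 144 is the square of 12 = 6 * 2, with 6 from [cexp_bound] and 2 from [sqr_le_exp]. *)
pose M := Num.sqrt (144 * (pi^-1 * Rintegral area setT (kernel_bound w))).
pose r h z := k z (w + h) - k z w - h^* * q z.
have Lr h : L2 (r h).
  by apply: (carrierB pL); [apply: (carrierB pL); exact: L2_kernel | exact: (carrierZ pL)].
have rM h : nc h <= 1 -> hnorm L2space (r h) <= nc h ^+ 2 * M.
  move=> h1; have [mr mi _] := Lr h.
  have c0 : 0 <= 12 * nc h ^+ 2 by rewrite mulr_ge0 // sqr_ge0.
  have [|_] := L2_dominated mr mi (integrable_kernel_bound w) (sqd_kernel_bound c0 _).
    move=> z; have -> : r h z = k z w * (cexp (z * h^*) - 1 - z * h^*).
      by rewrite /r /q /fock_kernel rmorphD mulrDr cexpD; ring.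
    rewrite ncM [X in _ <= _ * X]mulrC mulrCA ler_wpM2l ?nc_ge0 //.
    apply: le_trans (cexp_bound _) _; rewrite ncM ncJ.
    have z0 := nc_ge0 z; have h0 := nc_ge0 h.
    (* This is where |h| <= 1 enters: one factor exp(|z|) absorbs exp(|z h|), the other absorbs
       |z|^2. *)
    have zh : nc z * nc h <= nc z by rewrite ler_piMr.
    have -> : expR (2 * nc z) = expR (nc z) * expR (nc z) by rewrite mulr_natl mulr2n expRD.
    have E1 : expR (nc z * nc h) <= expR (nc z) by rewrite ler_expR.
    have -> : 6 * (nc z * nc h) ^+ 2 * expR (nc z * nc h) =
       6 * nc h ^+ 2 * (nc z ^+ 2 * expR (nc z * nc h)) by ring.
    have -> : 12 * nc h ^+ 2 * (expR (nc z) * expR (nc z)) =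
       6 * nc h ^+ 2 * ((2 * expR (nc z)) * expR (nc z)) by ring.
    rewrite ler_wpM2l ?mulr_ge0 ?sqr_ge0 // ler_pM ?sqr_ge0 ?expR_ge0 //.
    exact: sqr_le_exp.
  have X0 : 0 <= 144 * (pi^-1 * Rintegral area setT (kernel_bound w)).
    rewrite mulr_ge0 // mulr_ge0 ?invr_ge0 ?pi_ge0 //; apply: Rintegral_ge0 => p _.
    by rewrite mulr_ge0 // sumr_ge0 // => j _; exact: sqd_ge0.
  move=> le; rewrite -(ler_pXn2r (n := 2)) ?nnegrE ?hnorm_ge0 //; last first.
    by rewrite mulr_ge0 ?sqr_ge0 // sqrtr_ge0.
  apply: le_trans le _; rewrite [leRHS]exprMn sqr_sqrtr // le_eqVlt; apply/orP; left.
  by apply/eqP; ring.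
exists (fock_inner f q) => e e0.
have M0 : 0 <= M by exact: sqrtr_ge0.
pose K := hnorm L2space f * M.
have K0 : 0 <= K by rewrite mulr_ge0 ?hnorm_ge0.
have K1 : 0 < K + 1 by rewrite ltr_wpDl.
exists (Num.min 1 (e / (K + 1))) => [|h]; first by rewrite lt_min ltr01 divr_gt0.
rewrite lt_min => /andP[/ltW h1 /ltW h2].
have -> : f (w + h) - f w - fock_inner f q * h = inner L2space f (r h).
  have Lk := @L2_kernel R; have Lkk : L2 (fun z => k z (w + h) - k z w) := carrierB pL (Lk _) (Lk _).
  have LZ : L2 (fun z => h^* * q z) := carrierZ pL h^* Lq.
  rewrite (innerBr pL Lkk LZ Lf) (innerBr pL (Lk _) (Lk _) Lf) (innerZr pL _ Lq Lf) conjCK.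
  by by rewrite /= -!rep [h * _]mulrC.
apply: le_trans (cauchy_schwarz pL Lf (Lr h)) _.
apply: le_trans (ler_wpM2l (hnorm_ge0 _ _) (rM h h1)) _.
have -> : hnorm L2space f * (nc h ^+ 2 * M) = (K * nc h) * nc h by rewrite /K; ring.
rewrite ler_wpM2r ?nc_ge0 //; apply: le_trans (ler_wpM2l K0 h2) _.
by rewrite mul_div1_le // ltW.
Qed.

Lemma real_cauchy_cvg (x : nat -> R) :
  (forall e : R, 0 < e -> exists N, forall m n, (N <= m)%N -> (N <= n)%N -> `|x m - x n| < e) ->
  exists l : R, x @ \oo --> l.
Proof.
move=> cx; apply/cvg_ex; apply: cauchy_cvg; apply/cauchy_exP => e e0.
have [N HN] := cx e e0; exists (x N); exists N => // n /= Nn.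
exact: HN.
Qed.

Lemma integral_sqd f : L2 f -> (\int[area]_p (sqd f p)%:E = (pi * hnorm L2space f ^+ 2)%:E)%E.
Proof.
move=> Lf; have := sqnorm_hnorm Lf; rewrite fock_sqnormE.
have [_ _ sf] := Lf; have fin := integrable_fin_num measurableT sf.
rewrite -(fineK fin) -EFinM => -[] <-; congr (_%:E).
by rewrite mulrA divff ?mul1r // gt_eqF // pi_gt0.
Qed.

Lemma limn_einf_le (x : nat -> \bar R) (c : \bar R) (N : nat) :
  (forall m, (N <= m)%N -> (x m <= c)%E) -> (limn_einf x <= c)%E.
Proof.
move=> xc; rewrite limn_einf_lim; apply: lime_le; first exact: is_cvg_einfs.
apply: nearW => n; rewrite /einfs /=; apply: ge_ereal_inf.
exists (x (maxn n N)); last by apply: xc; rewrite leq_maxr.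
by exists (maxn n N) => //=; rewrite leq_maxl.
Qed.

Lemma fock_complete (u : nat -> R[i] -> R[i]) : (forall n, carrier fock (u n)) ->
    (forall e : R, 0 < e -> exists N : nat, forall m n : nat,
       (N <= m)%N -> (N <= n)%N -> hnorm fock (fun z => u m z - u n z) < e) ->
    exists2 f : R[i] -> R[i], carrier fock f &
      (fun n => hnorm fock (fun z => u n z - f z)) @ \oo --> (0 : R).
Proof.
move=> Cu cau; have pF := fock_prehilbert R.
have Lu n : L2 (u n) := fock_L2 (Cu n).
have Lk := @L2_kernel R.
(* [q] is the real or the imaginary part. Evaluation at z is the inner product with k_z, so by
   Cauchy-Schwarz a norm-Cauchy sequence is Cauchy at each point. *)
have pt (q : R[i] -> R) z : (forall z w, `|q z - q w| <= nc (z - w)) ->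
    exists l : R, (fun n => q (u n z)) @ \oo --> l.
  move=> Lq; apply: real_cauchy_cvg => e e0.
  have K0 : 0 < hnorm L2space (k^~ z) + 1 by rewrite ltr_wpDl ?hnorm_ge0.
  have [N HN] := cau _ (divr_gt0 e0 K0); exists N => m n mN nN.
  apply: le_lt_trans (Lq _ _) _.
  have Cmn := carrierB pF (Cu m) (Cu n).
  rewrite -(fock_reproducing z Cmn).
  apply: le_lt_trans (cauchy_schwarz pL (fock_L2 Cmn) (Lk z)) _.
  apply: le_lt_trans (_ : _ <= hnorm L2space (fun z => u m z - u n z) * (hnorm L2space (k^~ z) + 1)) _.
    by rewrite ler_wpM2l ?hnorm_ge0 // lerDl.
  by rewrite -ltr_pdivlMr //; exact: HN.
have [fr Hr] := choice (fun z => pt (@complex.Re R) z (@Re_lip R)).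
have [fi Hi] := choice (fun z => pt (@complex.Im R) z (@Im_lip R)).
pose f z := fr z +i* fi z.
have mfr : meas (fun p => complex.Re (f (cpt p))).
  apply: (@measurable_realfun.measurable_fun_cvg _ _ _ setT (fun n p => complex.Re (u n (cpt p)))).
    by move=> n; have [] := Lu n.
  by move=> p _; exact: Hr.
have mfi : meas (fun p => complex.Im (f (cpt p))).
  apply: (@measurable_realfun.measurable_fun_cvg _ _ _ setT (fun n p => complex.Im (u n (cpt p)))).
    by move=> n; have [] := Lu n.
  by move=> p _; exact: Hi.
have main (e : R) : 0 < e -> exists N : nat, forall n, (N <= n)%N ->
    L2 (fun z => u n z - f z) /\ hnorm L2space (fun z => u n z - f z) <= e.
  move=> e0; have [N HN] := cau e e0; exists N => n nN.
  (* n is fixed and Fatou's lemma is applied as m grows, turning the Cauchy bound into a bound for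
     the distance from [u n] to the pointwise limit. *)
  pose F m p : \bar R := (sqd (fun z => u n z - u m z) p)%:E.
  have Fcv p : F ^~ p @ \oo --> (sqd (fun z => u n z - f z) p)%:E.
    apply: cvg_EFin; first by apply: nearW.
    have -> : sqd (fun z => u n z - f z) p =
       ((complex.Re (u n (cpt p)) - fr (cpt p)) ^+ 2 + (complex.Im (u n (cpt p)) - fi (cpt p)) ^+ 2) * gwt p.
      by rewrite /sqd ncE ReB ImB.
    have -> : fine \o F ^~ p = (fun m => ((complex.Re (u n (cpt p)) - complex.Re (u m (cpt p))) ^+ 2 +
       (complex.Im (u n (cpt p)) - complex.Im (u m (cpt p))) ^+ 2) * gwt p).
      by apply/funext => m; rewrite /F /= /sqd ncE ReB ImB.
    have cr : (fun m => complex.Re (u n (cpt p)) - complex.Re (u m (cpt p))) @ \oo -->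
        complex.Re (u n (cpt p)) - fr (cpt p) by apply: cvgB; [exact: cvg_cst|exact: Hr].
    have ci : (fun m => complex.Im (u n (cpt p)) - complex.Im (u m (cpt p))) @ \oo -->
        complex.Im (u n (cpt p)) - fi (cpt p) by apply: cvgB; [exact: cvg_cst|exact: Hi].
    by apply: cvgM; [apply: cvgD; exact: cvgM | exact: cvg_cst].
  have mF m : meas (F m).
    by apply/measurable_EFinP; have [? ? _] := fock_L2 (carrierB pF (Cu n) (Cu m)); exact: measurable_sqd.
  have F0 m p : setT p -> (0 <= F m p)%E by move=> _; rewrite lee_fin sqd_ge0.
  have := fatou area measurableT mF F0.
  have -> : (\int[area]_p limn_einf (F^~ p) = \int[area]_p (sqd (fun z => u n z - f z) p)%:E)%E.
    by apply: eq_integral => p _; rewrite is_cvg_limn_einfE; [exact/cvg_lim|apply/cvg_ex; eexists; exact: Fcv].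
  have p0 : 0 < pi :> R := pi_gt0 R.
  have fle : (limn_einf (fun m => \int[area]_p F m p) <= (pi * e ^+ 2)%:E)%E.
    apply: (@limn_einf_le _ _ N) => m mN; rewrite /F integral_sqd; last exact: fock_L2 (carrierB pF (Cu n) (Cu m)).
    rewrite lee_fin ler_pM2l // ler_pXn2r ?nnegrE ?hnorm_ge0 ?(ltW e0) //.
    exact: ltW (HN n m nN mN).
  move/le_trans/(_ fle) => fat.
  have [unr uni _] := Lu n.
  have mr : meas (fun p => complex.Re (u n (cpt p) - f (cpt p))).
    have -> : (fun p => complex.Re (u n (cpt p) - f (cpt p))) =
        (fun p => complex.Re (u n (cpt p)) - complex.Re (f (cpt p))) by apply/funext => p; rewrite ReB.
    exact: measurable_funB.
  have mi : meas (fun p => complex.Im (u n (cpt p) - f (cpt p))).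
    have -> : (fun p => complex.Im (u n (cpt p) - f (cpt p))) =
        (fun p => complex.Im (u n (cpt p)) - complex.Im (f (cpt p))) by apply/funext => p; rewrite ImB.
    exact: measurable_funB.
  have Lnf : L2 (fun z => u n z - f z).
    split => //; apply: integrable_nonneg; [exact: measurable_sqd | exact: sqd_ge0 |].
    exact: le_lt_trans fat (ltry _).
  split => //; move: fat; rewrite integral_sqd // lee_fin ler_pM2l //.
  by rewrite ler_pXn2r ?nnegrE ?hnorm_ge0 // ltW.
have Lf : L2 f.
  have [N /(_ N (leqnn N))[Lnf _]] := main 1 ltr01.
  have -> : f = (fun z => u N z - (u N z - f z)) by apply/funext => z; rewrite opprB addrC subrK.
  exact: (carrierB pL (Lu N) Lnf).
(* Both sides are limits of the values at w of the functions [u n], the left one by pointwise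
   convergence and the right one by norm convergence. *)
have rep w : f w = fock_inner f (k^~ w).
  have lim (q : R[i] -> R) : (forall z w, `|q z - q w| <= nc (z - w)) ->
      (fun n => q (u n w)) @ \oo --> q (fock_inner f (k^~ w)).
    move=> Lq; apply/cvgrPdist_le => e e0.
    have K0 : 0 < hnorm L2space (k^~ w) + 1 by rewrite ltr_wpDl ?hnorm_ge0.
    have [N HN] := main _ (divr_gt0 e0 K0); exists N => // n /HN[Lnf le].
    rewrite distrC; apply: le_trans (Lq _ _) _.
    rewrite -(fock_reproducing w (Cu n)) -[X in nc X](innerBl pL (Lu n) Lf (Lk w)).
    apply: le_trans (cauchy_schwarz pL Lnf (Lk w)) _.
    apply: le_trans (ler_wpM2r (hnorm_ge0 _ _) le) _.
    by rewrite mulrC mul_div1_le ?hnorm_ge0 // ltW.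
  have e1 : fr w = complex.Re (fock_inner f (k^~ w)).
    exact: (@cvg_unique _ _ _ _ _ _ (Hr w) (lim _ (@Re_lip R))).
  have e2 : fi w = complex.Im (fock_inner f (k^~ w)).
    exact: (@cvg_unique _ _ _ _ _ _ (Hi w) (lim _ (@Im_lip R))).
  by rewrite /f e1 e2; case: (fock_inner _ _).
exists f; first by apply: L2_fock => //; exact: L2_reproducing_entire.
apply/cvgrPdist_le => e e0; have [N HN] := main e e0; exists N => // n /HN[_ le].
by rewrite sub0r normrN ger0_norm; [exact: le | exact: hnorm_ge0].
Qed.

Theorem fock_rkhs : rkhs fock (@fock_kernel R).
Proof.
have pF := fock_prehilbert R.
split; last by move=> w; split; [exact: fock_kernel_carrier | move=> f Cf; exact: fock_reproducing].
split.
- exact: (prehilbert_zero pF).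
- exact: (prehilbert_lin_closed pF).
- exact: (prehilbert_inner_linear pF).
- exact: (prehilbert_inner_conj pF).
- exact: (prehilbert_inner_ge0 pF).
- move=> f Cf f0; apply/funext => w; rewrite -(fock_reproducing w Cf).
  apply/eqP; rewrite -nc_eq0 eq_le nc_ge0 andbT.
  apply: le_trans (cauchy_schwarz pF Cf (fock_kernel_carrier w)) _.
  by rewrite [hnorm _ f]/hnorm f0 sqrtr0 mul0r.
- exact: fock_complete.
Qed.

Lemma fock_kernel_cderiv z w : cderiv (k^~ w) z = w^* * k z w.
Proof.
have -> : k^~ w = (fun z => cexp (w^* * z)) by apply/funext => v; rewrite /fock_kernel mulrC.
by rewrite (cdiff_cderiv (cdiff_cexpM _ _)) mulrC /fock_kernel [z * _]mulrC.
Qed.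

Lemma fock_deriv_dense : densely_defined fock (diff_op fock).
Proof.
move=> f e Cf e0; have [g kg lt] := kernel_span_dense fock_rkhs Cf e0.
exists g => //; move: g kg {lt}; have pF := fock_prehilbert R.
have d0 : cderiv (fun=> 0) = (fun=> 0) :> (R[i] -> R[i]).
  by apply/funext => z; exact: cdiff_cderiv (cdiff_cst 0 z).
apply: kernel_span_ind.
  by split; rewrite ?d0; exact: (carrier0 pF).
move=> a w g kg [Cg Cdg]; split; first exact: (carrier_lin pF _ (fock_kernel_carrier w)).
have -> : cderiv (fun z => a * k z w + g z) = (fun z => a * (w^* * k z w) + cderiv g z).
  apply/funext => z; apply: cdiff_cderiv; apply: cdiff_lin; last first.
    by apply: derivable_cdiff; case: Cg => eg _; exact: eg.
  rewrite -fock_kernel_cderiv; apply: derivable_cdiff; exact: entire_kernel.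
by apply: (carrier_lin pF) => //; apply: (carrierZ pF); exact: fock_kernel_carrier.
Qed.

End FockComplete.

Theorem proposition2p5 (R : realType) :
  [/\ rkhs (fock R) (@fock_kernel R),
      carrier (fock R) `<=` @entire R,
      nonzero_space (fock R),
      densely_defined (fock R) (diff_op (fock R)) &
      op_eq_on (adjoint (fock R) (diff_op (fock R))) (mul_op (fock R))
               (kernel_span (@fock_kernel R))] /\
  (forall (H : fspace R) (k : R[i] -> R[i] -> R[i]),
     rkhs H k ->
     carrier H `<=` @entire R ->
     nonzero_space H ->
     densely_defined H (diff_op H) ->
     op_eq_on (adjoint H (diff_op H)) (mul_op H) (kernel_span k) ->
     exists c : R, 0 < c /\
       forall z w : R[i], k z w = c%:C * cexp (z * w^*)).
Proof.
have fent : carrier (fock R) `<=` @entire R by move=> f [].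
split; last by move=> H k rk Hent; exact: kernel_of_adjoint_deriv.
split => //.
- exact: fock_rkhs.
- exists ((@fock_kernel R)^~ 0); split; first exact: fock_kernel_carrier.
  move/(congr1 (@^~ 0)); rewrite /fock_kernel mul0r => /eqP.
  by rewrite (negbTE (cexp_neq0 _)).
- exact: fock_deriv_dense.
- apply: (mul_adjoint_deriv (@fock_rkhs R) fent (@fock_deriv_dense R)) => z w.
  exact: fock_kernel_cderiv.
Qed.
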